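(* Let $\mathcal D$ be a triangulated category. For each connected component $\Sigma\subset\mathrm{Stab}_{\mathrm{Pol}}(\mathcal D)$ there is a topological vector space $V(\Sigma)$, which is a subspace of $\mathrm{Hom}(K(\mathcal D),\mathbb C[m])$ — namely $V(\Sigma)=\{U:\|U\|_\sigma<\infty\}$ for $\sigma\in\Sigma$, with the topology generated by the topology of point-wise convergence and the semi-norms $\|\cdot\|_\sigma$, $\sigma\in\Sigma$ — such that the forgetful map $\Sigma\to V(\Sigma)$ given by $(Z,\mathcal P)\mapsto Z$ is continuous.
   Context: Polynomial phase functions: $S$ is the set of continuous function germs $\phi\colon(\mathbb R\cup\{+\infty\},+\infty)\to\mathbb R$ for which there is $P\in\mathbb C[m]$ with $P(m)\in\mathbb R_{>0}e^{\pi i\phi(m)}$ for $m\gg0$; ordered by $\phi\prec\psi$ iff $\phi(m)<\psi(m)$ for all large finite $m$; shift $\phi\mapsto\phi+1$. An $S$-valued slicing $\mathcal P$ of $\mathcal D$ consists of full additive extension-closed subcategories $\mathcal P(\phi)$, $\phi\in S$, with $\mathcal P(\phi+1)=\mathcal P(\phi)[1]$; $\mathrm{Hom}(A,B)=0$ for $A\in\mathcal P(\phi)$, $B\in\mathcal P(\psi)$, $\phi\succ\psi$; and such that every nonzero $E\in\mathcal D$ has a finite Harder–Narasimhan filtration by exact triangles $E_{i-1}\to E_i\to A_i$, $E_0=0$, $E_r=E$, with $A_i\in\mathcal P(\phi_i)$ and $\phi_1\succ\dots\succ\phi_r$. A polynomial stability condition on $\mathcal D$ is a pair $(Z,\mathcal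 P)$ with $\mathcal P$ an $S$-valued slicing and $Z\colon K(\mathcal D)\to\mathbb C[m]$ a group homomorphism such that $0\ne E\in\mathcal P(\phi)$ implies $Z(E)(m)\in\mathbb R_{>0}e^{\pi i\phi(m)}$ for $m\gg0$. $\mathrm{Stab}_{\mathrm{Pol}}(\mathcal D)$ is the set of these. Nonzero objects of $\mathcal P(\phi)$ are called semistable. Semi-metric on slicings: let $\phi^-_{\mathcal P}(X)$ and $\phi^+_{\mathcal P}(X)$ be the values at $m=+\infty$ of the smallest and largest phase in the Harder–Narasimhan filtration of $0\ne X\in\mathcal D$ with respect to $\mathcal P$; then $$d_S(\mathcal P,\mathcal Q)=\sup_{0\ne X\in\mathcal D}\{|\phi^-_{\mathcal P}(X)-\phi^-_{\mathcal Q}(X)|,\ |\phi^+_{\mathcal P}(X)-\phi^+_{\mathcal Q}(X)|\}\in[0,\infty].$$ Semi-norms (allowed to take the value $\infty$ and to vanish on nonzero vectors): for $\sigma=(Z,\mathcal P)$ and $U\in\mathrm{Hom}(K(\mathcal D),\mathbb C[m])$, $$\|U\|_\sigma=\sup\Big\{\limsup_{m\to\infty}\frac{|U(E)(m)|}{|Z(E)(m)|}\ :\ E\text{ semistable in }\sigma\Big\}\in[0,\infty].$$ Topology: for $0<\epsilon<\frac14$ let $B_\epsilon(\sigma)=\{\tau=(W,\mathcal Q)\in\mathrm{Stab}_{\mathrm{Pol}}(\mathcal D):\|W-Z\|_\sigma<\sin(\pi\epsilon),\ d_S(\mathcal P,\mathcal Q)<\epsilon\}$. $\mathrm{Stab}_{\mathrm{Pol}}(\mathcal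 D)$ carries the topology with subbasis consisting of all $B_\epsilon(\sigma)$ and all preimages under $(Z,\mathcal P)\mapsto Z$ of open sets of $\mathrm{Hom}(K(\mathcal D),\mathbb C[m])$ in the topology of point-wise convergence (with $\mathbb C[m]$ given its natural vector space topology, which restricts to the usual topology on polynomials of bounded degree). For $\tau\in B_\epsilon(\sigma)$ the semi-norms $\|\cdot\|_\sigma$ and $\|\cdot\|_\tau$ are equivalent, so the subspace $\{U:\|U\|_\sigma<\infty\}$ is constant for $\sigma$ in a connected component $\Sigma$. *)

(* Defs.v *)
From HB Require Import structures.
From mathcomp Require Import all_boot all_order all_algebra.
From mathcomp Require Import generic_quotient ring_quotient.
From mathcomp Require Import complex.
From mathcomp Require Import freeg.
From mathcomp Require Import all_classical all_reals all_analysis.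

Set Implicit Arguments.
Unset Strict Implicit.
Unset Printing Implicit Defensive.

Import Order.TTheory GRing.Theory Num.Theory.
Import numFieldNormedType.Exports.

Local Open Scope classical_set_scope.
Local Open Scope ring_scope.
Local Open Scope quotient_scope.

Record preadditiveCat := PreadditiveCat {
  obj :> Type;
  hom : obj -> obj -> zmodType;
  idc : forall A, hom A A;
  compc : forall A B C, hom B C -> hom A B -> hom A C;
  compA : forall A B C D (h : hom C D) (g : hom B C) (f : hom A B),
    compc h (compc g f) = compc (compc h g) f;
  comp1c : forall A B (f : hom A B), compc (idc B) f = f;
  compc1 : forall A B (f : hom A B), compc f (idc A) = f;
  compDl : forall A B C (g g' : hom B C) (f : hom A B),
    compc (g + g') f = compc g f + compc g' f;
  compDr : forall A B C (g : hom B C) (f f' : hom A B),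
    compc g (f + f') = compc g f + compc g f'
}.

Arguments idc {p} A.
Arguments compc {p A B C}.
Notation "g \;o f" := (compc g f) (at level 40, left associativity).

Section PreadditiveCat.
Variable C : preadditiveCat.

Definition is_zero (A : C) : Prop := idc A = 0.

Definition is_iso (A B : C) (f : hom A B) : Prop :=
  exists g : hom B A, g \;o f = idc A /\ f \;o g = idc B.

Definition isomorphic (A B : C) : Prop := exists f : hom A B, is_iso f.

(* [S] is a direct sum of [A] and [B]; the remaining identities [p1 i2 = 0]
   and [p2 i1 = 0] follow. *)
Definition is_biproduct (A B S : C) : Prop :=
  exists (i1 : hom A S) (i2 : hom B S) (p1 : hom S A) (p2 : hom S B),
    [/\ p1 \;o i1 = idc A, p2 \;o i2 = idc B
      & i1 \;o p1 + i2 \;o p2 = idc S].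

End PreadditiveCat.

(* The shift is an additive auto-equivalence (not necessarily a strict
   automorphism). *)
Record triangulatedCat := TriangulatedCat {
  tcat :> preadditiveCat;
  zero_obj : tcat;
  zero_objP : is_zero zero_obj;
  biprod_ex : forall A B : tcat, exists S, is_biproduct A B S;
  sh : tcat -> tcat;
  shm : forall A B : tcat, hom A B -> hom (sh A) (sh B);
  shm1 : forall A, shm (idc A) = idc (sh A);
  shmM : forall A B C (g : hom B C) (f : hom A B),
    shm (g \;o f) = shm g \;o shm f;
  shmD : forall A B (f g : hom A B), shm (f + g) = shm f + shm g;
  shm_bij : forall A B, bijective (@shm A B);
  sh_esurj : forall A, exists B, isomorphic (sh B) A;
  (* [is_exact f g h] : A --f--> B --g--> C --h--> A[1] is an exact triangle *)
  is_exact : forall A B C : tcat, hom A B -> hom B C -> hom C (sh A) -> Prop;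
  exact_iso : forall A B C A' B' C'
      (f : hom A B) (g : hom B C) (h : hom C (sh A))
      (f' : hom A' B') (g' : hom B' C') (h' : hom C' (sh A'))
      (a : hom A A') (b : hom B B') (c : hom C C'),
    is_iso a -> is_iso b -> is_iso c ->
    b \;o f = f' \;o a -> c \;o g = g' \;o b -> shm a \;o h = h' \;o c ->
    is_exact f g h -> is_exact f' g' h';
  exact_id : forall A,
    is_exact (idc A) (0 : hom A zero_obj) (0 : hom _ (sh A));
  exact_cone : forall A B (f : hom A B),
    exists C (g : hom B C) (h : hom C (sh A)), is_exact f g h;
  exact_rot : forall A B C (f : hom A B) (g : hom B C) (h : hom C (sh A)),
    is_exact f g h <-> is_exact g h (- shm f);
  exact_mor : forall A B C A' B' C'
      (f : hom A B) (g : hom B C) (h : hom C (sh A))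
      (f' : hom A' B') (g' : hom B' C') (h' : hom C' (sh A'))
      (a : hom A A') (b : hom B B'),
    is_exact f g h -> is_exact f' g' h' -> b \;o f = f' \;o a ->
    exists c : hom C C', c \;o g = g' \;o b /\ shm a \;o h = h' \;o c;
  exact_octahedral : forall A B C C' A' B'
      (f : hom A B) (j : hom B C') (k : hom C' (sh A))
      (g : hom B C) (l : hom C A') (i : hom A' (sh B))
      (m : hom C B') (n : hom B' (sh A)),
    is_exact f j k -> is_exact g l i -> is_exact (g \;o f) m n ->
    exists (u : hom C' B') (v : hom B' A'),
      [/\ is_exact u v (shm j \;o i),
          u \;o j = m \;o g, n \;o u = k,
          v \;o m = l & i \;o v = shm f \;o n]
}.

Definition exact_tri (D : triangulatedCat) (A B C : D) : Prop :=
  exists (f : hom A B) (g : hom B C) (h : hom C (sh A)), is_exact f g h.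

Section GrothendieckGroup.
Variable D : triangulatedCat.

Definition freeOb := {freeg {classic D} / int}.

Definition free_class (A : D) : freeOb := << (A : {classic D}) >>.

Definition is_subgroup (G : set freeOb) : Prop :=
  G 0 /\ forall x y, G x -> G y -> G (x - y).

Definition K0_relator : set freeOb :=
  [set x | exists A B C : D, exact_tri A B C /\
     x = free_class B - (free_class A + free_class C)].

Definition K0_relations : {pred freeOb} :=
  [pred x | `[< smallest is_subgroup K0_relator x >]].

Fact K0_relations_zmod_closed : zmod_closed K0_relations.
Proof.
split=> [|x y].
  by apply: asboolT => G [[G0 _] _].
move=> /asboolW Gx /asboolW Gy; apply: asboolT => G HG.
by case: (HG) => -[_ GB] _; apply: GB; [exact: Gx|exact: Gy].
Qed.

HB.instance Definition _ :=
  GRing.isZmodClosed.Build freeOb K0_relations K0_relations_zmod_closed.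

Definition K0 : zmodType := Quotient.quot K0_relations.

Definition K0_class (A : D) : K0 :=
  \pi_(Quotient.quot K0_relations) (free_class A).

End GrothendieckGroup.

(* The inductive limit topology of the finite-dimensional spaces of polynomials
   of bounded degree: a set is open iff its trace on polynomials of degree [< n]
   is open for every [n]. *)
Section PolyTopology.
Variable K : numFieldType.

Definition poly_open : set_system {poly K} :=
  [set A | forall n, open [set v : 'rV[K]_n | A (rVpoly v)]].

Fact poly_openT : poly_open setT.
Proof. by move=> n; exact: openT. Qed.

Fact poly_openI : setI_closed poly_open.
Proof. by move=> A B oA oB n; apply: openI; [exact: oA|exact: oB]. Qed.

Fact poly_open_bigU (I : Type) (f : I -> set {poly K}) :
  (forall i, poly_open (f i)) -> poly_open (\bigcup_i f i).
Proof.
move=> of_ n.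
rewrite (_ : [set v | _] = \bigcup_i [set v : 'rV[K]_n | f i (rVpoly v)]) //.
by apply: bigcup_open => i _; exact: of_.
Qed.

HB.instance Definition _ :=
  isOpenTopological.Build {poly K} poly_openT poly_openI poly_open_bigU.

End PolyTopology.

Section HomK.
Variables (R : realType) (D : triangulatedCat).

Definition is_hom : {pred K0 D -> {poly R[i]}} :=
  [pred U | `[< forall x y, U (x + y) = U x + U y >]].

Fact is_hom_submod_closed : submod_closed is_hom.
Proof.
split=> [|a U V].
  by apply: asboolT => x y; rewrite /GRing.zero/= addr0.
move=> /asboolW HU /asboolW HV; apply: asboolT => x y.
change (a *: U (x + y) + V (x + y) = (a *: U x + V x) + (a *: U y + V y)).
by rewrite HU HV scalerDr addrACA.
Qed.

HB.instance Definition _ :=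
  GRing.isSubmodClosed.Build R[i] (K0 D -> {poly R[i]}) is_hom
    is_hom_submod_closed.

Record homK := HomK {
  homK_fun :> K0 D -> {poly R[i]};
  homK_is_hom : homK_fun \in is_hom }.

HB.instance Definition _ := [isSub for homK_fun].
HB.instance Definition _ := [Choice of homK by <:].
HB.instance Definition _ := [SubChoice_isSubLmodule of homK by <:].

(* Topology of pointwise convergence. *)
HB.instance Definition _ := Topological.copy homK
  (initial_topology (homK_fun : homK -> {ptws K0 D -> {poly R[i]}})).

End HomK.

Section Phases.
Variable R : realType.

(* exp(pi i t) *)
Definition expipi (t : R) : R[i] := Complex (cos (pi * t)) (sin (pi * t)).

(* [P(m)] lies on the ray R_{>0} exp(pi i f(m)) for m >> 0 *)
Definition has_phase (P : {poly R[i]}) (f : \bar R -> R) : Prop :=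
  \forall m \near +oo%R,
    exists2 r : R, 0 < r & P.[(m%:C)%C] = (r%:C)%C * expipi (f m%:E).

(* Neighbourhoods of +oo in [\bar R] contain +oo itself. *)
Record phase_rep := PhaseRep {
  phase_fun :> \bar R -> R;
  phase_cont : \forall x \near +oo%E, {for x, continuous phase_fun};
  phase_poly : exists P, has_phase P phase_fun }.

HB.instance Definition _ := gen_eqMixin phase_rep.
HB.instance Definition _ := gen_choiceMixin phase_rep.

Definition same_germ (f g : phase_rep) : bool :=
  `[< \forall x \near +oo%E, f x = g x >].

Fact same_germ_equiv : equiv_class_of same_germ.
Proof.
split=> [f|f g|f g h].
- by apply/asboolP; near=> x.
- by apply/asboolP/asboolP; apply: filterS => x ->.
- move=> /asboolP fg /asboolP gh; apply/asboolP.
  by apply: filterS2 fg gh => x -> ->.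
Unshelve. all: by end_near. Qed.

Canonical same_germ_equivRel := EquivRelPack same_germ_equiv.
Canonical same_germ_encModRel := defaultEncModRel same_germ.

Definition phase := {eq_quot same_germ}.
HB.instance Definition _ := Choice.on phase.
HB.instance Definition _ : EqQuotient phase_rep same_germ phase :=
  EqQuotient.on phase.

Definition phase_lt (phi psi : phase) : Prop :=
  \forall m \near +oo%R, repr phi m%:E < repr psi m%:E.

Fact shift_cont (f : phase_rep) :
  \forall x \near +oo%E, {for x, continuous (fun y => f y + 1)}.
Proof.
by apply: filterS (phase_cont f) => x cf; apply: continuousD => //; exact: cst_continuous.
Qed.

Fact shift_poly (f : phase_rep) : exists P, has_phase P (fun y => f y + 1).
Proof.
have [P HP] := phase_poly f; exists (- P).
apply: filterS HP => m [r r0 Pm]; exists r => //.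
rewrite hornerN Pm -mulrN; congr (_ * _).
by rewrite /expipi mulrDr mulr1 cosDpi sinDpi.
Qed.

Definition phase_rep_shift (f : phase_rep) : phase_rep :=
  PhaseRep (shift_cont f) (shift_poly f).

Definition phase_shift (phi : phase) : phase :=
  \pi_phase (phase_rep_shift (repr phi)).

Definition phase_lim (phi : phase) : R := repr phi +oo%E.

End Phases.

Section Stability.
Variables (R : realType) (D : triangulatedCat).

Record HNfiltration (P : phase R -> D -> Prop) (X : D) := {
  hn_len : nat;
  hn_obj : nat -> D;
  hn_fac : nat -> D;
  hn_phase : nat -> phase R;
  hn_obj0 : is_zero (hn_obj 0%N);
  hn_objr : hn_obj hn_len = X;
  hn_tri : forall i, (i < hn_len)%N ->
    exact_tri (hn_obj i) (hn_obj i.+1) (hn_fac i);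
  hn_fac_ss : forall i, (i < hn_len)%N -> P (hn_phase i) (hn_fac i);
  hn_fac_neq0 : forall i, (i < hn_len)%N -> ~ is_zero (hn_fac i);
  hn_decr : forall i j, (i < j < hn_len)%N ->
    phase_lt (hn_phase j) (hn_phase i) }.

(* Full subcategories are given by their classes of objects.  Closure under
   isomorphism follows from [sl_zero] and [sl_ext]. *)
Record slicing := Slicing {
  sl_cat :> phase R -> D -> Prop;
  sl_zero : forall phi A, is_zero A -> sl_cat phi A;
  sl_sum : forall phi A B S, sl_cat phi A -> sl_cat phi B ->
    is_biproduct A B S -> sl_cat phi S;
  sl_ext : forall phi A B C, exact_tri A B C ->
    sl_cat phi A -> sl_cat phi C -> sl_cat phi B;
  sl_shift : forall phi A, sl_cat (phase_shift phi) A <->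
    exists2 B, sl_cat phi B & isomorphic (sh B) A;
  sl_hom : forall phi psi A B, sl_cat phi A -> sl_cat psi B ->
    phase_lt psi phi -> forall f : hom A B, f = 0;
  sl_HN : forall E, ~ is_zero E -> inhabited (HNfiltration sl_cat E) }.

(* Largest and smallest phase of the Harder-Narasimhan filtration of [X != 0],
   evaluated at +oo (factors are numbered from 0). *)
Definition phi_plus (P : slicing) (X : D) : R :=
  xget 0 [set t | exists F : HNfiltration P X, t = phase_lim (hn_phase F 0%N)].

Definition phi_minus (P : slicing) (X : D) : R :=
  xget 0 [set t | exists F : HNfiltration P X,
                    t = phase_lim (hn_phase F (hn_len F).-1)].

(* The element 0 makes the supremum of an empty family equal to 0. *)
Definition slicing_dist (P Q : slicing) : \bar R :=
  ereal_sup [set z | z = 0%E \/ exists2 X : D, ~ is_zero X &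
    z = `|phi_minus P X - phi_minus Q X|%:E \/
    z = `|phi_plus P X - phi_plus Q X|%:E].

Record stab := Stab {
  central_charge : homK R D;
  slices : slicing;
  central_charge_phase : forall phi E, ~ is_zero E -> slices phi E ->
    has_phase (central_charge (K0_class E)) (repr phi) }.

HB.instance Definition _ := gen_eqMixin stab.
HB.instance Definition _ := gen_choiceMixin stab.

Definition semistable (s : stab) (E : D) : Prop :=
  ~ is_zero E /\ exists phi, slices s phi E.

Definition poly_abs (P : {poly R[i]}) (m : R) : R := Normc.normc P.[(m%:C)%C].

(* The element 0 makes the supremum of an empty family equal to 0. *)
Definition seminorm (s : stab) (U : homK R D) : \bar R :=
  ereal_sup [set z | z = 0%E \/ exists2 E : D, semistable s E &
    z = limf_esup (fun m : R =>
          (poly_abs (U (K0_class E)) m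
             / poly_abs (central_charge s (K0_class E)) m)%:E) +oo%R].

Definition stab_ball (s : stab) (e : R) : set stab :=
  [set t | (seminorm s (central_charge t - central_charge s)%R < (sin (pi * e))%:E)%E /\
           (slicing_dist (slices s) (slices t) < e%:E)%E].

Definition stab_subbasis : set_system stab :=
  [set A | exists s e, 0 < e < 4^-1 /\ A = stab_ball s e] `|`
  [set central_charge @^-1` O | O in open].

End Stability.

Definition generated_topology (T : Type) (B : set_system T) : Type := T.

HB.instance Definition _ (T : choiceType) (B : set_system T) :=
  Choice.on (generated_topology B).
HB.instance Definition _ (T : choiceType) (B : set_system T) :=
  isSubBaseTopological.Build (generated_topology B) B id.

HB.instance Definition _ (R : realType) (D : triangulatedCat) :=
  Topological.copy (stab R D) (generated_topology (@stab_subbasis R D)).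

Definition is_connected_component (T : topologicalType) (A : set T) : Prop :=
  exists x, A = connected_component [set: T] x.

(* For a linear injection [iota] of [V] into Hom(K(D), C[m]), the subbasis given
   by the topology of pointwise convergence and the balls of the semi-norms
   attached to the points of [Sigma]. *)
Definition seminorm_subbasis (R : realType) (D : triangulatedCat)
    (Sigma : set (stab R D)) (V : zmodType) (iota : V -> homK R D) :
    set_system V :=
  [set iota @^-1` O | O in open] `|`
  [set A | exists s v e, [/\ Sigma s, 0 < e &
     A = [set w | (seminorm s (iota w - iota v)%R < e%:E)%E]]].

(* Main.v *)
Require Import Defs.
From HB Require Import structures.
From mathcomp Require Import all_boot all_order all_algebra.
From mathcomp Require Import generic_quotient ring_quotient.
From mathcomp Require Import complex freeg finmap.
From mathcomp Require Import all_classical all_reals all_analysis.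
From mathcomp Require Import ring lra.

Set Implicit Arguments.
Unset Strict Implicit.
Unset Printing Implicit Defensive.

Import Order.TTheory GRing.Theory Num.Theory.
Import numFieldNormedType.Exports.

Local Open Scope classical_set_scope.
Local Open Scope ring_scope.

(** Fix a component [Sigma] and let [V] consist of the charges [U] all of whose
    semi-norms [|U|_s], [s] in [Sigma], are finite.  Continuity of [(Z, P) |-> Z]
    into [V] is immediate for the pointwise part of the topology of [V].  For the
    semi-norm of a point [u] of [Sigma] it requires a comparison of [|.|_u] with
    [|.|_s] at the point [s] where continuity is tested, because the ball around
    [s] only controls [|W - Z|_s].  So everything rests on the equivalence of
    the semi-norms of [Sigma], which also gives [V = {U : |U|_s < oo}] for each
    single [s].

    Equivalence on one ball ([ball_dominates]) is an argument about sectors.  If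
    [E] is semistable for [t] in the ball of radius [e] around [s], then all
    Harder-Narasimhan phases of [E] with respect to [s] are, in the limit,
    within [e] of one constant.  Hence for large [m] the numbers [Z(A_i)(m)] lie
    in a sector of half-angle [pi e < pi / 4], the sum of their moduli is at most
    [|Z(E)(m)| / cos (pi e)], and a bound for [U] on the factors [A_i] gives one on
    [E] ([sector_bound]).  Applied to [W - Z] this yields
    [|W(E) - Z(E)| <= tan (pi e) |Z(E)|] with [tan (pi e) < 1], so [|Z(E)|] and
    [|W(E)|] are comparable.  The points with semi-norm equivalent to a given one
    therefore form a clopen set, which contains the connected component
    ([connected_component_dominates]).

    The limiting extreme phases enter the metric through an arbitrary choice of
    filtration; that they do not depend on it ([phi_plusE], [phi_minusE]) follows
    from the usual vanishing of morphisms against the phase order, using only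
    exact sequences of [Hom] groups in weak form ([weak_kernel], [weak_cokernel]).

    That [V] is a topological vector space reduces, coefficientwise, to the
    continuity of addition and scaling on polynomials with the inductive limit
    topology.  Since the complex plane is locally compact, that topology has the
    boxes [{x : x_i in N_i for all i}] as neighbourhood bases
    ([poly_box_nbhs], [poly_nbhs_box]), and boxes can be treated one coefficient
    at a time. *)

(** * Topologies generated by a subbasis *)

Section GeneratedTopology.
Variables (T : choiceType) (B : set_system T).

Lemma generated_open (A : set T) : B A -> @open (generated_topology B) A.
Proof.
move=> BA; exists [set A]; last by exact: bigcup_set1.
move=> _ ->; exists [fset A]%fset; first by move=> ? /fset1P ->; apply/mem_set.
rewrite predeqE => t; split=> [|At ? /fset1P -> //].
by apply; exact: fset11.
Qed.

Lemma generated_cvg (F : set_system T) (x : T) : Filter F ->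
  (forall A, B A -> A x -> F A) -> F --> (x : generated_topology B).
Proof.
move=> FF BF U; rewrite nbhsE => -[_ [[D sD <-] [C DC Cx]] sU].
have [E sE CE] := sD _ DC; apply: (@filterS _ _ _ C).
  by move=> y Cy; apply: sU; exists C.
rewrite -CE in Cx *; apply: filter_bigI => i Ei.
by apply: BF; [exact/set_mem/sE|exact: Cx].
Qed.

End GeneratedTopology.

(** * Polynomials with the inductive limit topology *)

Section PolyTopologyTheory.
Variable K : numFieldType.
Implicit Types (a b x : {poly K}) (N : nat -> set K).

Lemma poly_openP (A : set {poly K}) :
  open A <-> forall n, open [set v : 'rV[K]_n | A (rVpoly v)].
Proof. by []. Qed.

(** On polynomials of bounded degree only finitely many of the conditions
    [x_i in N_i] involve the argument; the others read [0 in N_i], so they hold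
    for all [x] or for none. *)
Lemma poly_box_nbhs a N : (forall i, nbhs a`_i (N i)) ->
  nbhs a [set x : {poly K} | forall i, N i x`_i].
Proof.
move=> aN; rewrite nbhsE/=.
exists [set x : {poly K} | forall i, (N i)° x`_i] => /=; last first.
  by move=> x + i => /(_ i); exact: interior_subset.
split=> //; apply/poly_openP => n.
(* Conditions beyond the degree bound: all satisfied, or the trace is empty. *)
have [far|nfar] := pselect (forall i, (n <= i)%N -> (N i)° 0); last first.
  rewrite (_ : mkset _ = set0); first exact: open0.
  rewrite -subset0 => v /= vN; apply: nfar => i ni.
  by have := vN i; rewrite nth_default// (leq_trans _ ni)// size_poly.
rewrite openE => v /= vN.
have : \forall w \near v, forall i : 'I_n, (N i)° ((w : 'rV[K]_n) ord0 i).
  apply: (@filter_forall _ 'I_n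
    (fun i => [set w : 'rV[K]_n | (N i)° (w ord0 i)]) (nbhs v) _) => i.
  apply: (@coord_continuous K 1 n ord0 i v).
  have := vN i; rewrite coef_rVpoly_ord => vNi.
  by apply: open_nbhs_nbhs; split=> //; exact: open_interior.
apply: filterS => w wN i; have [ni|ni] := ltnP i n.
  by have := wN (Ordinal ni); rewrite -coef_rVpoly_ord.
by rewrite nth_default; [exact: far|rewrite (leq_trans (size_poly _ _))].
Qed.

(** The boxes of [poly_nbhs_box] are built one coefficient at a time by the tube
    lemma, for which their sides have to be compact. *)
Hypothesis K_loc_compact : forall (c : K) (N : set K), nbhs c N ->
  exists S, [/\ nbhs c S, compact S & S `<=` N].

(** The tube lemma: if a box with compact sides in the coefficients below [n]
    lies in an open [A], the coefficient [n] may be freed within some compact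
    neighbourhood [T] of its value [a_n]. *)
Lemma poly_box_step (A : set {poly K}) a n (S : nat -> set K) :
  open A -> (forall i, (i < n)%N -> compact (S i)) ->
  (forall x, (forall i, (i < n)%N -> S i x`_i) ->
    (forall i, (n <= i)%N -> x`_i = a`_i) -> A x) ->
  exists T, [/\ nbhs a`_n T, compact T &
    forall x, (forall i, (i < n)%N -> S i x`_i) -> T x`_n ->
      (forall i, (n < i)%N -> x`_i = a`_i) -> A x].
Proof.
move=> oA cS SA.
(* All polynomials concerned have degree below M. *)
pose M := maxn (size a) n.+1.
pose Q (i : 'I_M) : set K := if (i < n)%N then S i else [set a`_i].
have /compact_near_coveringP cQ : compact [set v : 'rV[K]_M | forall i, Q i (v ord0 i)].
  apply: rV_compact => i; rewrite /Q; case: ifP => [|_]; first exact: cS.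
  exact: compact_set1.
have nM : (n < M)%N by rewrite leq_maxr.
pose g (v : 'rV[K]_M) (t : K) : 'rV[K]_M := v + (t - a`_n) *: delta_mx ord0 (Ordinal nM).
have gC v : {for (v, a`_n), continuous (fun z : 'rV[K]_M * K => g z.1 z.2)}.
  apply: continuousD; first exact: cvg_fst.
  by apply: continuousZr_tmp; apply: continuousB; [exact: cvg_snd|exact: cst_continuous].
have : \forall t \near a`_n,
    [set v : 'rV[K]_M | forall i, Q i (v ord0 i)] `<=` (fun v => A (rVpoly (g v t))).
apply: (@cQ K (nbhs a`_n) (fun t (v : 'rV[K]_M) => A (rVpoly (g v t))) _) => v /= vQ.
  suff nv : nbhs (g v a`_n) [set w | A (rVpoly w)] by exact: (gC v _ nv).
  apply: open_nbhs_nbhs; split; first exact: (proj1 (poly_openP A) oA M).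
  rewrite /g subrr scale0r addr0 /=; apply: SA => i.
    move=> ni; have iM : (i < M)%N by rewrite (ltn_trans ni).
    by have := vQ (Ordinal iM); rewrite /Q ni -coef_rVpoly_ord.
  move=> ni; have [iM|iM] := ltnP i M.
    have := vQ (Ordinal iM); rewrite /Q ltnNge ni /= => <-.
    by rewrite -coef_rVpoly_ord.
  rewrite (nth_default _ (leq_trans (leq_maxl _ _) iM)).
  by rewrite nth_default// (leq_trans (size_poly _ _)).
move=> /K_loc_compact[T [aT cT TA]]; exists T; split=> // x xS xT xa.
pose v : 'rV[K]_M := \row_i (if (i : nat) == n then a`_n else x`_i).
have := TA _ xT v; have -> : rVpoly (g v x`_n) = x.
  apply/polyP => i; have [iM|iM] := ltnP i M; last first.
    rewrite (xa _ (leq_trans nM iM)) (nth_default _ (leq_trans (leq_maxl _ _) iM)).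
    by rewrite nth_default// (leq_trans (size_poly _ _)).
  rewrite (coef_rVpoly_ord (g v x`_n) (Ordinal iM)) !mxE eqxx/= -val_eqE/=.
  have [->|] := eqVneq i n; first by rewrite mulr1 addrC subrK.
  by rewrite mulr0 addr0.
apply=> i; rewrite /Q mxE; have [ni|ni] := ltnP i n.
  by rewrite ltn_eqF//; exact: xS.
have [->//|ni'] := eqVneq (i : nat) n; rewrite /= xa// ltn_neqAle ni andbT.
by rewrite eq_sym.
Qed.

(** The state after [n] steps of the construction of a box around [a] in [A]:
    coefficients below [n] range over compact neighbourhoods, the others are
    still pinned to those of [a]. *)
Definition poly_box_inv (A : set {poly K}) a n (S : nat -> set K) :=
  [/\ forall i, (i < n)%N -> nbhs a`_i (S i),
      forall i, (i < n)%N -> compact (S i) &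
      forall x, (forall i, (i < n)%N -> S i x`_i) ->
        (forall i, (n <= i)%N -> x`_i = a`_i) -> A x].

(** A given [x] in the final box differs from [a] in finitely many coefficients
    only, so membership in [A] is already decided at a finite stage. *)
Lemma poly_nbhs_box a (A : set {poly K}) : nbhs a A ->
  exists2 N : nat -> set K, forall i, nbhs a`_i (N i) &
    [set x : {poly K} | forall i, N i x`_i] `<=` A.
Proof.
rewrite nbhsE => -[B [oB Ba] BA].
have step n (S : nat -> set K) : exists T, poly_box_inv B a n S ->
    [/\ nbhs a`_n T, compact T &
    forall x, (forall i, (i < n)%N -> S i x`_i) -> T x`_n ->
      (forall i, (n < i)%N -> x`_i = a`_i) -> B x].
  have [[_ cS SB]|] := pselect (poly_box_inv B a n S); last by exists setT.
  by have [T HT] := poly_box_step oB cS SB; exists T.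
have [F HF] := choice (fun p => step p.1 p.2).
pose fix L n : seq (set K) :=
  if n is m.+1 then rcons (L m) (F (m, nth setT (L m))) else [::].
have sL n : size (L n) = n by elim: n => //= n IH; rewrite size_rcons IH.
have inv n : poly_box_inv B a n (nth setT (L n)).
  elim: n => [|n IH].
    by split=> // x _ xa; rewrite (_ : x = a)//; apply/polyP => i; exact: xa.
  have [/= aT cT TB] := HF (n, _) IH; have [aS cS _] := IH.
  split=> [i|i|x xL xa]; rewrite /= ?nth_rcons ?sL.
  - rewrite ltnS; case: ltngtP => //= ni _; [exact: aS|by rewrite ni].
  - rewrite ltnS; case: ltngtP => //= ni _; exact: cS.
  apply: TB => //.
  - by move=> i ni; have := xL i (ltnW ni); rewrite /= nth_rcons sL ni.
  - by have := xL n (ltnSn n); rewrite /= nth_rcons sL ltnn eqxx.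
have LE m n i : (i < m)%N -> (m <= n)%N -> nth setT (L n) i = nth setT (L m) i.
  move=> im; elim: n => [|n IH]; first by rewrite leqn0 => /eqP mn; rewrite mn in im.
  rewrite leq_eqVlt => /predU1P[->//|]; rewrite ltnS => mn /=.
  by rewrite nth_rcons sL (leq_trans im mn) IH.
exists (fun i => nth setT (L i.+1) i) => [i|x xN].
  by have [+ _ _] := inv i.+1; apply.
apply: BA; have [_ _] := inv (maxn (size x) (size a)); apply => i.
  by move=> ni; rewrite (LE i.+1).
by rewrite geq_max => /andP[xi ai]; rewrite !nth_default.
Qed.

Lemma poly_add_continuous : continuous (fun z : {poly K} * {poly K} => z.1 + z.2).
Proof.
move=> [a b] A /poly_nbhs_box[N abN NA].
have addN i : exists PQ : set K * set K, [/\ nbhs a`_i PQ.1, nbhs b`_i PQ.2 &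
    forall s t, PQ.1 s -> PQ.2 t -> N i (s + t)].
  have := abN i; rewrite coefD => /(@add_continuous K (a`_i, b`_i))[[P Q] [aP bQ] PQ].
  by exists (P, Q); split=> // s t sP tQ; exact: (PQ (s, t)).
have [PQ HPQ] := choice addN.
exists ([set x : {poly K} | forall i, (PQ i).1 x`_i],
        [set x : {poly K} | forall i, (PQ i).2 x`_i]).
  split=> /=.
    by apply: (@poly_box_nbhs a (fun i => (PQ i).1)) => i; have [] := HPQ i.
  by apply: (@poly_box_nbhs b (fun i => (PQ i).2)) => i; have [] := HPQ i.
move=> [x y] /= [xP yQ]; apply: NA => i; rewrite /= coefD.
by have [_ _] := HPQ i; apply.
Qed.

(** A neighbourhood of the scalar must serve all coefficients at once.  Where
    [a_i] is not [0], which happens finitely often, it may depend on [i]; where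
    [a_i = 0] the unit ball around the scalar works for every [i]. *)
Lemma poly_scale_continuous : continuous (fun z : K^o * {poly K} => z.1 *: z.2).
Proof.
move=> [k a] A /poly_nbhs_box[N kaN NA].
have mulN i : exists PQ : set K * set K, [/\ nbhs k PQ.1, nbhs a`_i PQ.2,
    a`_i = 0 -> ball k 1 `<=` PQ.1 &
    forall s t, PQ.1 s -> PQ.2 t -> N i (s * t)].
  have := kaN i; rewrite coefZ /=.
  have [a0|a0] := eqVneq a`_i 0.
    rewrite ?a0 mulr0 => /nbhs_ballP[e /= e0 eN].
    exists (ball k 1, ball (0 : K) (e / (`|k| + 1))) => /=.
    have k1 : 0 < `|k| + 1 by rewrite ltr_wpDl.
    split.
    - exact: nbhsx_ballx.
    - by rewrite ?a0; apply: nbhsx_ballx; rewrite divr_gt0.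
    - by move=> _ s.
    move=> s t ks tP; have te : `|t| < e / (`|k| + 1).
      by move: tP; rewrite -ball_normE /= sub0r normrN.
    apply: eN.
    rewrite -ball_normE /= sub0r normrN normrM.
    have sk : `|s| <= `|k| + 1.
      rewrite -(subrK k s) addrC (le_trans (ler_normD _ _))// lerD2l.
      by move: ks; rewrite -ball_normE /= distrC => /ltW.
    rewrite (le_lt_trans (ler_wpM2r _ sk))//.
    by rewrite mulrC -ltr_pdivlMr.
  move=> /(@mul_continuous K (k, a`_i))[[P Q] [aP bQ] PQ].
  exists (P, Q); split=> //; first by move=> /eqP; rewrite (negbTE a0).
  by move=> s t sP tQ; exact: (PQ (s, t)).
have [PQ HPQ] := choice mulN.
exists (ball k 1 `&` [set s : K | forall i : 'I_(size a), (PQ i).1 s],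
        [set x : {poly K} | forall i, (PQ i).2 x`_i]).
  split=> /=; last first.
    by apply: (@poly_box_nbhs a (fun i => (PQ i).2)) => i; have [] := HPQ i.
  apply: filterI; first exact: nbhsx_ballx.
  apply: (@filter_forall K 'I_(size a) (fun i => (PQ i).1) (nbhs k) _) => i.
  by have [] := HPQ i.
move=> [s x] /= [[ks sP] xQ]; apply: NA => i; rewrite /= coefZ.
have [_ _ Pi] := HPQ i; apply => //.
have [ia|ia] := ltnP i (size a); first exact: (sP (Ordinal ia)).
by apply: Pi => //; rewrite nth_default.
Qed.

End PolyTopologyTheory.

(** * The complex plane is locally compact *)

Section ComplexPlane.
Variable R : realType.
Local Notation C := (complex_complex__canonical__Num_NumField R).

Lemma normC_normc (z : R[i]) : `|z| = (Normc.normc z)%:C%C.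
Proof. by []. Qed.

Lemma norm_ReIm_le (z : R[i]) : Normc.normc z <= `|complex.Re z| + `|complex.Im z|.
Proof.
case: z => x y /=; rewrite -ler_sqr ?nnegrE ?sqrtr_ge0 ?addr_ge0//.
rewrite sqr_sqrtr ?addr_ge0 ?sqr_ge0// sqrrD !real_normK ?num_real//.
by rewrite lerD2r lerDl mulrn_wge0// mulr_ge0.
Qed.

Lemma normRe_le (z : R[i]) : `|complex.Re z| <= Normc.normc z.
Proof.
case: z => x y /=; rewrite -ler_sqr ?nnegrE ?sqrtr_ge0//.
by rewrite sqr_sqrtr ?addr_ge0 ?sqr_ge0// real_normK ?num_real// lerDl sqr_ge0.
Qed.

Lemma normIm_le (z : R[i]) : `|complex.Im z| <= Normc.normc z.
Proof.
case: z => x y /=; rewrite -ler_sqr ?nnegrE ?sqrtr_ge0//.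
by rewrite sqr_sqrtr ?addr_ge0 ?sqr_ge0// real_normK ?num_real// lerDr sqr_ge0.
Qed.

(** Balls of the numeric field [R[i]] have complex radii; real radii suffice. *)
Lemma complex_nbhsP (c : C) (N : set C) :
  nbhs c N <-> exists2 e : R, 0 < e & forall z, Normc.normc (z - c) < e -> N z.
Proof.
split=> [/nbhs_ballP[[e1 e2] /=]|[e e0 eN]].
  rewrite ltcE /= => /andP[/eqP-> e0] eN; exists e1 => // z zc; apply: eN.
  by rewrite -ball_normE /= distrC normC_normc (ltcR _ e1).
apply/nbhs_ballP; exists (e%:C)%C; first by rewrite /= (ltcR 0 e).
by move=> z; rewrite -ball_normE /= distrC normC_normc ltcR; exact: eN.
Qed.

Lemma complex_loc_compact (c : C) (N : set C) : nbhs c N ->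
  exists S, [/\ nbhs c S, compact S & S `<=` N].
Proof.
move=> /complex_nbhsP[e e0 eN].
pose f (p : R * R) : C := (p.1 +i* p.2)%C.
have fcont : continuous f.
  move=> [x y] A /complex_nbhsP[d d0 dA].
  have d20 : 0 < d / 2 by rewrite divr_gt0.
  exists (ball x (d / 2), ball y (d / 2)); first by split; exact: nbhsx_ballx.
  move=> [x' y'] [/= xx' yy']; apply: dA; rewrite (le_lt_trans (norm_ReIm_le _))//=.
  by rewrite [ltRHS]splitr ltrD// distrC.
have r0 : 0 < e / 4 by rewrite divr_gt0.
set r := e / 4 in r0.
exists (f @` (`[complex.Re c - r, complex.Re c + r] `*`
              `[complex.Im c - r, complex.Im c + r])); split.
- apply/complex_nbhsP; exists r => // z zc.
  exists (complex.Re z, complex.Im z) => /=; last by case: (z).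
  have := le_lt_trans (normRe_le _) zc; have := le_lt_trans (normIm_le _) zc.
  rewrite !raddfB /= !in_itv/= => /ltW; rewrite ler_distl => Iz /ltW; rewrite ler_distl.
  by [].
- apply: continuous_compact; first exact: continuous_subspaceT.
  by apply: compact_setX; exact: segment_compact.
- move=> _ [[x y] [/= + +] <-]; rewrite !in_itv/= -!ler_distl => xc yc.
  apply: eN; rewrite (le_lt_trans (norm_ReIm_le _))// !raddfB /=.
  rewrite (@le_lt_trans _ _ (r + r)) ?lerD// /r; lra.
Qed.

End ComplexPlane.

(** * Pointwise convergence of charges *)

Section HomKTopology.
Variables (R : realType) (D : triangulatedCat).
Implicit Types U V : homK R D.
Local Notation C := (complex_complex__canonical__Num_NumField R).

Lemma homK_eval_cont (k : K0 D) : continuous (fun V : homK R D => V k).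
Proof.
move=> U A; rewrite /= nbhsE => -[B [oB BU] BA].
rewrite nbhsE; exists [set V : homK R D | B (V k)].
  split=> //; exists [set f : {ptws K0 D -> {poly C}} | B (f k)] => //.
  apply: (@open_comp {ptws K0 D -> {poly C}} _ (fun f => f k)) => //.
  by move=> f _; exact: (@proj_continuous _ (fun=> {poly C}) k f).
by move=> V; exact: BA.
Qed.

Lemma homK_cvg (T : Type) (F : set_system T) (f : T -> homK R D) U : Filter F ->
  (forall k, (fun t => f t k) @ F --> U k) -> f @ F --> U.
Proof.
move=> FF FU A [_ [[B oB <-] BU BA]].
suff : F (f @^-1` [set V | B (V : K0 D -> {poly C})]).
  by apply: filterS => t; exact: BA.
have : (fun t => f t : {ptws K0 D -> {poly C}}) @ F --> (U : {ptws K0 D -> {poly C}}).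
  apply/cvg_sup => k; move=> E [_ [[G oG <-] GU GE]].
  rewrite nbhs_filterE; apply: filterS GE _.
  by apply: FU; apply: open_nbhs_nbhs.
by apply; apply: open_nbhs_nbhs.
Qed.

Lemma homK_add_continuous : continuous (fun z : homK R D * homK R D => z.1 + z.2).
Proof.
move=> [U V]; apply: homK_cvg => k.
apply: (@continuous_comp _ _ _ (fun z : homK R D * homK R D => (z.1 k, z.2 k))
  (fun z : {poly C} * {poly C} => z.1 + z.2)); last first.
  exact: (@poly_add_continuous C (@complex_loc_compact R) (U k, V k)).
apply: (@cvg_pair _ _ _ (nbhs (U, V)) (nbhs (U k)) (nbhs (V k))).
  apply: (@cvg_comp _ _ _ fst (fun V : homK R D => V k)); first exact: cvg_fst.
  exact: homK_eval_cont.
apply: (@cvg_comp _ _ _ snd (fun V : homK R D => V k)); first exact: cvg_snd.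
exact: homK_eval_cont.
Qed.

Lemma homK_scale_continuous : continuous (fun z : R[i]^o * homK R D => z.1 *: z.2).
Proof.
move=> [c V]; apply: homK_cvg => k.
apply: (@continuous_comp _ _ _ (fun z : R[i]^o * homK R D => ((z.1 : C^o), z.2 k))
  (fun z : C^o * {poly C} => z.1 *: z.2)); last first.
  exact: (@poly_scale_continuous C (@complex_loc_compact R) (c, V k)).
apply: (@cvg_pair _ _ _ (nbhs (c, V)) (nbhs c) (nbhs (V k))); first exact: cvg_fst.
apply: (@cvg_comp _ _ _ snd (fun V : homK R D => V k)); first exact: cvg_snd.
exact: homK_eval_cont.
Qed.

End HomKTopology.

(** * Weak kernels and cokernels in a triangulated category *)

Local Notation hom := Defs.hom.

Section PreadditiveTheory.
Variable C : preadditiveCat.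
Implicit Types A B X : C.

Lemma comp0c A B X (f : hom A B) : (0 : hom B X) \;o f = 0.
Proof. by apply: (addrI (0 \;o f)); rewrite -compDl !addr0. Qed.

Lemma compc0 A B X (g : hom B X) : g \;o (0 : hom A B) = 0.
Proof. by apply: (addrI (g \;o 0)); rewrite -compDr !addr0. Qed.

Lemma compNc A B X (g : hom B X) (f : hom A B) : (- g) \;o f = - (g \;o f).
Proof. by apply/eqP; rewrite -addr_eq0 -compDl addNr comp0c. Qed.

Lemma compcN A B X (g : hom B X) (f : hom A B) : g \;o (- f) = - (g \;o f).
Proof. by apply/eqP; rewrite -addr_eq0 -compDr addNr compc0. Qed.

Lemma is_iso_id A : is_iso (idc A).
Proof. by exists (idc A); rewrite comp1c. Qed.

Lemma isomorphic_refl A : isomorphic A A.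
Proof. by exists (idc A); exact: is_iso_id. Qed.

Lemma hom_to_zero A B (f : hom A B) : is_zero B -> f = 0.
Proof. by move=> B0; rewrite -(comp1c f) B0 comp0c. Qed.

Lemma hom_from_zero A B (f : hom A B) : is_zero A -> f = 0.
Proof. by move=> A0; rewrite -(compc1 f) A0 compc0. Qed.

Lemma is_iso_zero A B (f : hom A B) : is_zero A -> is_zero B -> is_iso f.
Proof.
by move=> A0 B0; exists 0; rewrite comp0c compc0 (A0 : idc A = 0) (B0 : idc B = 0).
Qed.

End PreadditiveTheory.

Section TriangulatedTheory.
Variable D : triangulatedCat.
Implicit Types A B C X : D.

Lemma shm0 A B : shm (0 : hom A B) = 0.
Proof. by apply: (addrI (shm 0)); rewrite -shmD !addr0. Qed.

Lemma shm_inj A B (f g : hom A B) : shm f = shm g -> f = g.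
Proof. exact: (bij_inj (shm_bij A B)). Qed.

Lemma shm_surj A B (f : hom (sh A) (sh B)) : exists g, f = shm g.
Proof. by have [g _ gK] := shm_bij A B; exists (g f). Qed.

Lemma sh_zero A : is_zero A -> is_zero (sh A).
Proof. by rewrite /is_zero => A0; rewrite -shm1 A0 shm0. Qed.

(** Exactness of [Hom(X, A) -> Hom(X, B) -> Hom(X, C)]: complete the square from
    the rotated triangle [X -> 0 -> X[1]] to the rotated given triangle, and
    undo the shift on the resulting morphism [X[1] -> A[1]]. *)
Lemma weak_kernel A B C (f : hom A B) (g : hom B C) (h : hom C (sh A)) X
  (x : hom X B) : is_exact f g h -> g \;o x = 0 -> exists y, x = f \;o y.
Proof.
move=> /exact_rot E gx0; have /exact_rot EX := exact_id X.
have [|c [_]] := exact_mor EX E (a := x) (b := 0); first by rewrite gx0 comp0c.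
rewrite shm1 compcN compc1 compNc => /oppr_inj.
by have [y ->] := shm_surj c; rewrite -shmM => /shm_inj ->; exists y.
Qed.

Lemma exact_0_id X :
  is_exact (0 : hom (zero_obj D) X) (idc X) (0 : hom X (sh (zero_obj D))).
Proof.
have Z := zero_objP D; apply/exact_rot; rewrite shm0 oppr0.
apply: (exact_iso (a := idc X) (b := idc X) (c := 0)) (exact_id X).
- exact: is_iso_id.
- exact: is_iso_id.
- by apply: is_iso_zero => //; exact: sh_zero.
- by [].
- by rewrite ?comp0c ?compc0.
- by rewrite ?comp0c ?compc0.
Qed.

(** Exactness of [Hom(C, X) -> Hom(B, X) -> Hom(A, X)]: a morphism [B -> X]
    killed by [f] extends to a morphism to the triangle [0 -> X -> X]. *)
Lemma weak_cokernel A B C (f : hom A B) (g : hom B C) (h : hom C (sh A)) X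
  (x : hom B X) : is_exact f g h -> x \;o f = 0 -> exists y, x = y \;o g.
Proof.
move=> E xf0.
have [|c [cg _]] := exact_mor E (exact_0_id X) (a := 0) (b := x).
  by rewrite xf0 comp0c.
by exists c; rewrite cg comp1c.
Qed.

Lemma exact_tri_zero X Z : is_zero Z -> exact_tri Z X X.
Proof.
move=> Z0; exists 0, (idc X), 0.
have Z0' := zero_objP D.
apply: (exact_iso (a := 0) (b := idc X) (c := idc X)) (exact_0_id X).
- exact: is_iso_zero.
- exact: is_iso_id.
- exact: is_iso_id.
- by rewrite ?comp0c ?compc0.
- by [].
- by rewrite ?comp0c ?compc0.
Qed.

End TriangulatedTheory.

(** * Classes in the Grothendieck group *)

Section GrothendieckTheory.
Variable D : triangulatedCat.
Implicit Types A B C : D.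

Lemma K0_class_exact A B C :
  exact_tri A B C -> K0_class B = K0_class A + K0_class C.
Proof.
move=> ABC; rewrite /K0_class -[RHS]raddfD; apply/eqmodP.
change (free_class B - (free_class A + free_class C) \in @K0_relations D).
by apply: asboolT => G [_]; apply; exists A, B, C.
Qed.

Lemma K0_class_zero A : is_zero A -> K0_class A = 0.
Proof.
move=> /(exact_tri_zero A)/K0_class_exact/(congr1 (fun x => x - K0_class A)).
by rewrite addrK subrr => <-.
Qed.

End GrothendieckTheory.

(** * Phases and their limits *)

Section PhaseTheory.
Variable R : realType.
Implicit Types phi psi : phase R.

(** Continuity near [+oo] in the extended reals includes continuity at [+oo]
    itself. *)
Lemma phase_lim_cvg (phi : phase R) :
  (fun m : R => repr phi m%:E) @ +oo%R --> phase_lim phi.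
Proof.
have c := nbhs_singleton (phase_cont (repr phi)).
apply: (@cvg_comp _ _ _ (fun m : R => m%:E) (repr phi)); last exact: c.
by apply/cvgeryP; exact: cvg_id.
Qed.

Arguments phase_lim_cvg : clear implicits.

(** This stands in for totality of the order: phases from two different
    filtrations are compared only when their limits differ. *)
Lemma phase_lt_lim phi psi : phase_lim phi < phase_lim psi -> phase_lt phi psi.
Proof.
move=> lt.
have hphi : \forall m \near +oo%R, repr phi m%:E < (phase_lim phi + phase_lim psi) / 2.
  by apply: (cvgr_lt _ (phase_lim_cvg phi)); exact: (midf_lt lt).1.
have hpsi : \forall m \near +oo%R, (phase_lim phi + phase_lim psi) / 2 < repr psi m%:E.
  by apply: (cvgr_gt _ (phase_lim_cvg psi)); exact: (midf_lt lt).2.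
by apply: filterS2 hphi hpsi => m; exact: lt_trans.
Qed.

Lemma phase_lt_trans phi psi chi :
  phase_lt phi psi -> phase_lt psi chi -> phase_lt phi chi.
Proof. by apply: filterS2 => m; exact: lt_trans. Qed.

Lemma phase_lt_lim_le phi psi : phase_lt phi psi -> phase_lim phi <= phase_lim psi.
Proof.
move=> lt; rewrite leNgt; apply/negP => /phase_lt_lim gt.
by have [m] := filter_ex (phase_lt_trans lt gt); rewrite ltxx.
Qed.

Lemma phase_lt_shift phi psi : phase_lt phi psi -> phase_lt phi (phase_shift psi).
Proof.
move=> lt.
have /eqmodP/asboolP e :
    (repr (phase_shift psi) = phase_rep_shift (repr psi) %[mod phase R])%qT.
  by rewrite reprK.
have {}e : \forall m \near +oo%R, repr (phase_shift psi) m%:E = repr psi m%:E + 1.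
  have : (fun m : R => m%:E) @ +oo%R --> +oo%E by apply/cvgeryP; exact: cvg_id.
  by move=> c; exact: (c _ e).
by apply: filterS2 lt e => m lt ->; rewrite (lt_trans lt)// ltrDl.
Qed.

End PhaseTheory.

(** * Harder-Narasimhan filtrations *)

Section HarderNarasimhan.
Variables (R : realType) (D : triangulatedCat) (P : slicing R D).
Implicit Types (X Y : D) (phi psi : phase R).

Lemma slicing_sh phi X : P phi X -> P (phase_shift phi) (sh X).
Proof. by move=> PX; apply/sl_shift; exists X => //; exact: isomorphic_refl. Qed.

Section Filtration.
Variables (X : D) (F : HNfiltration P X).

Lemma hn_len_gt0 : ~ is_zero X -> (0 < hn_len F)%N.
Proof.
move=> X0; rewrite lt0n; apply/negP => /eqP l0; apply: X0.
by rewrite -(hn_objr F) l0; exact: hn_obj0.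
Qed.

(** Vanishing of morphisms propagates from the factors to the steps of the
    filtration, on either side and after a shift. *)
Lemma hom_from_hn Y i : (i <= hn_len F)%N ->
  (forall j, (j < i)%N -> forall f : hom (hn_fac F j) Y, f = 0) ->
  forall f : hom (hn_obj F i) Y, f = 0.
Proof.
elim: i => [|i IH] iF HY f; first by apply: hom_from_zero; exact: hn_obj0.
have [u [v [w E]]] := hn_tri iF.
have [|y ->] := weak_cokernel (x := f) E; last by rewrite (HY i _ y)// comp0c.
by apply: IH => [|j ji]; [exact: ltnW|apply: HY; exact: ltnW].
Qed.

Lemma hom_to_hn Y i : (i <= hn_len F)%N ->
  (forall j, (j < i)%N -> forall f : hom Y (hn_fac F j), f = 0) ->
  forall f : hom Y (hn_obj F i), f = 0.
Proof.
elim: i => [|i IH] iF HY f; first by apply: hom_to_zero; exact: hn_obj0.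
have [u [v [w E]]] := hn_tri iF.
have [|y ->] := weak_kernel (x := f) E; first exact: HY.
by rewrite (IH _ _ y) ?compc0// => [|j ji]; [exact: ltnW|apply: HY; exact: ltnW].
Qed.

Lemma hom_from_sh_hn Y i : (i <= hn_len F)%N ->
  (forall j, (j < i)%N -> forall f : hom (sh (hn_fac F j)) Y, f = 0) ->
  forall f : hom (sh (hn_obj F i)) Y, f = 0.
Proof.
elim: i => [|i IH] iF HY f; first by apply: hom_from_zero; apply: sh_zero; exact: hn_obj0.
have [u [v [w /exact_rot/exact_rot/exact_rot E]]] := hn_tri iF.
have [|y ->] := weak_cokernel (x := f) E; last by rewrite (HY i _ y)// comp0c.
rewrite compcN (IH _ _ (_ \;o _)) ?oppr0// => [|j ji]; first exact: ltnW.
by apply: HY; exact: ltnW.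
Qed.

(** The first factor maps nontrivially to every later step: the obstruction to
    injectivity of [Hom(A_0, E_i) -> Hom(A_0, E_i+1)] is [Hom(A_0[1], A_i)], which
    vanishes because the phase of [A_0[1]] exceeds that of [A_i]. *)
Lemma hn_top_neq0 i : (i < hn_len F)%N ->
  exists f : hom (hn_fac F 0%N) (hn_obj F i.+1), f <> 0.
Proof.
elim: i => [|i IH] iF.
  have [u [v [w /exact_rot E]]] := hn_tri iF.
  have [|y yE] := weak_kernel (x := idc (hn_fac F 0%N)) E.
    by apply: hom_to_zero; apply: sh_zero; exact: hn_obj0.
  by exists y => y0; apply: (hn_fac_neq0 iF); rewrite /is_zero yE y0 compc0.
have [f f0] := IH (ltnW iF); have [u [v [w /exact_rot/exact_rot E]]] := hn_tri iF.
exists (u \;o f) => uf0; apply: f0; apply: shm_inj; rewrite shm0.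
have [|y ->] := weak_kernel (x := shm f) E.
  by rewrite compNc -shmM uf0 shm0 oppr0.
rewrite (_ : y = 0) ?compc0//.
apply: sl_hom (slicing_sh (hn_fac_ss (leq_ltn_trans (leq0n _) iF))) (hn_fac_ss iF) _ _.
by apply: phase_lt_shift; exact: hn_decr.
Qed.

(** If the projection to the last factor [A] vanished, the identity of [A] would
    factor through the shift of the previous step, all of whose factors have
    larger phase than [A]. *)
Lemma hn_bottom_neq0 i : i.+1 = hn_len F ->
  exists f : hom (hn_obj F i.+1) (hn_fac F i), f <> 0.
Proof.
move=> iF; have li : (i < hn_len F)%N by rewrite -iF.
have [u [v [w /exact_rot E]]] := hn_tri li.
exists v => v0; apply: (hn_fac_neq0 li).
have [|y yE] := weak_cokernel (x := idc (hn_fac F i)) E; first by rewrite v0 compc0.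
rewrite /is_zero yE (_ : y = 0) ?comp0c//.
apply: hom_from_sh_hn => [|j ji f]; first exact: ltnW.
apply: sl_hom (slicing_sh (hn_fac_ss (ltn_trans ji li))) (hn_fac_ss li) _ _.
by apply: phase_lt_shift; apply: hn_decr; rewrite ji.
Qed.

Lemma hn_phase_le i j : (i <= j < hn_len F)%N ->
  phase_lim (hn_phase F j) <= phase_lim (hn_phase F i).
Proof.
rewrite leq_eqVlt => /andP[/predU1P[->//|ij] jF].
by apply: phase_lt_lim_le; apply: hn_decr; rewrite ij.
Qed.

End Filtration.

(** Independence of the filtration.  If the top phase of [F] had the larger limit,
    it would exceed all phases of [G], so the nonzero morphism from the first
    factor of [F] to [X] would vanish. *)
Lemma hn_top_le X (F G : HNfiltration P X) : ~ is_zero X ->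
  phase_lim (hn_phase F 0%N) <= phase_lim (hn_phase G 0%N).
Proof.
move=> X0; have F0 := hn_len_gt0 F X0; rewrite leNgt; apply/negP => lt.
have l : ((hn_len F).-1 < hn_len F)%N by rewrite prednK.
suff : forall f : hom (hn_fac F 0%N) (hn_obj G (hn_len G)), f = 0.
  rewrite (hn_objr G) => F0G; have := hn_top_neq0 l.
  by rewrite prednK// hn_objr => -[f]; apply; exact: F0G.
apply: hom_to_hn => // j jG g.
apply: sl_hom (hn_fac_ss F0) (hn_fac_ss jG) _ _.
by apply: phase_lt_lim; apply: le_lt_trans lt; exact: hn_phase_le.
Qed.

Lemma hn_bottom_le X (F G : HNfiltration P X) : ~ is_zero X ->
  phase_lim (hn_phase F (hn_len F).-1) <= phase_lim (hn_phase G (hn_len G).-1).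
Proof.
move=> X0; have F0 := hn_len_gt0 F X0; have G0 := hn_len_gt0 G X0.
rewrite leNgt; apply/negP => lt.
have lG : ((hn_len G).-1 < hn_len G)%N by rewrite prednK.
suff : forall f : hom (hn_obj F (hn_len F)) (hn_fac G (hn_len G).-1), f = 0.
  rewrite (hn_objr F) => FG; have := @hn_bottom_neq0 _ G (hn_len G).-1.
  by rewrite prednK// => /(_ erefl); rewrite hn_objr => -[f]; apply; exact: FG.
apply: hom_from_hn => // j jF g.
apply: sl_hom (hn_fac_ss jF) (hn_fac_ss lG) _ _.
apply: phase_lt_lim; apply: lt_le_trans lt _; apply: hn_phase_le.
by rewrite -ltnS prednK// jF leqnn.
Qed.

(** [phi_plus] is computed from a chosen filtration, so this is where independence
    of the choice is needed. *)
Lemma phi_plusE X (F : HNfiltration P X) : ~ is_zero X ->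
  phi_plus P X = phase_lim (hn_phase F 0%N).
Proof.
move=> X0; rewrite /phi_plus; case: xgetP => [_ _ [G ->]|/(_ (phase_lim (hn_phase F 0%N)))].
  by apply/le_anti; rewrite !hn_top_le.
by case; exists F.
Qed.

Lemma phi_minusE X (F : HNfiltration P X) : ~ is_zero X ->
  phi_minus P X = phase_lim (hn_phase F (hn_len F).-1).
Proof.
move=> X0; rewrite /phi_minus; case: xgetP => [_ _ [G ->]|].
  by apply/le_anti; rewrite !hn_bottom_le.
by move=> /(_ (phase_lim (hn_phase F (hn_len F).-1))); case; exists F.
Qed.

(** With the independence of the filtration this identifies both extreme phases
    of a semistable object with its phase. *)
Lemma hn_semistable phi X : ~ is_zero X -> P phi X ->
  exists F : HNfiltration P X, hn_len F = 1%N /\ hn_phase F 0%N = phi.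
Proof.
move=> X0 PX.
pose o (i : nat) : D := if i is 0%N then zero_obj D else X.
have o_tri i : (i < 1)%N -> exact_tri (o i) (o i.+1) X.
  by case: i => // _; apply: exact_tri_zero; exact: zero_objP.
have no_pair i j : (i < j < 1)%N -> phase_lt phi phi.
  by case: j => [|j]; rewrite ?andbF// ltnS ltn0 andbF.
by exists (Build_HNfiltration (hn_len := 1) (hn_obj := o) (hn_fac := fun=> X)
  (hn_phase := fun=> phi) (zero_objP D) erefl o_tri (fun _ _ => PX)
  (fun _ _ => X0) no_pair).
Qed.

Lemma phi_plus_semistable phi X : ~ is_zero X -> P phi X ->
  phi_plus P X = phase_lim phi.
Proof.
move=> X0 PX; have [F [_ <-]] := hn_semistable X0 PX; exact: phi_plusE.
Qed.

Lemma phi_minus_semistable phi X : ~ is_zero X -> P phi X ->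
  phi_minus P X = phase_lim phi.
Proof.
move=> X0 PX; have [F [F1 <-]] := hn_semistable X0 PX.
by rewrite (phi_minusE F)// F1.
Qed.

Lemma homK_hn (U : homK R D) X (F : HNfiltration P X) :
  U (K0_class X) = \sum_(i < hn_len F) U (K0_class (hn_fac F i)).
Proof.
have [U0 UD] : U 0 = 0 /\ forall x y, U (x + y) = U x + U y.
  have UD := asboolW (homK_is_hom U); split=> //.
  by apply: (addrI (U 0)); rewrite -UD !addr0.
suff H i : (i <= hn_len F)%N ->
    U (K0_class (hn_obj F i)) = \sum_(j < i) U (K0_class (hn_fac F j)).
  by rewrite -[in LHS](hn_objr F) H.
elim: i => [|i IH] iF; first by rewrite big_ord0 (K0_class_zero (hn_obj0 F)).
by rewrite big_ord_recr/= -IH ?(ltnW iF)// (K0_class_exact (hn_tri iF)) UD.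
Qed.

End HarderNarasimhan.

(** * Moduli of polynomials and sectors *)

Section PolyAbs.
Variable R : realType.
Implicit Types (P Q : {poly R[i]}) (m : R).

Lemma poly_abs_ge0 P m : 0 <= poly_abs P m.
Proof. by rewrite /poly_abs; case: (_.[_]) => a b; rewrite sqrtr_ge0. Qed.

Lemma poly_abs0 m : poly_abs (0 : {poly R[i]}) m = 0.
Proof. by rewrite /poly_abs horner0 Normc.normc0. Qed.

Lemma poly_abs_triangle P Q m : poly_abs (P + Q) m <= poly_abs P m + poly_abs Q m.
Proof. by rewrite /poly_abs hornerD; exact: le_normcD. Qed.

Lemma poly_absN P m : poly_abs (- P) m = poly_abs P m.
Proof. by rewrite /poly_abs hornerN normcN. Qed.

Lemma poly_absZ (c : R[i]) P m : poly_abs (c *: P) m = Normc.normc c * poly_abs P m.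
Proof. by rewrite /poly_abs hornerZ Normc.normcM. Qed.

Lemma poly_abs_sum n (P : 'I_n -> {poly R[i]}) m :
  poly_abs (\sum_i P i) m <= \sum_i poly_abs (P i) m.
Proof.
elim/big_ind2: _ => [|x x' y y' xx' yy'|//]; first by rewrite poly_abs0.
by rewrite (le_trans (poly_abs_triangle _ _ _))// lerD.
Qed.

Lemma normc_expipi (r t : R) : 0 <= r -> Normc.normc (r%:C%C * expipi t) = r.
Proof.
move=> r0; rewrite Normc.normcM /= expr0n /= addr0 sqrtr_sqr cos2Dsin2 sqrtr1 mulr1.
exact: ger0_norm.
Qed.

Lemma has_phase_poly_abs_gt0 P f : has_phase P f ->
  \forall m \near +oo%R, 0 < poly_abs P m.
Proof. by apply: filterS => m [r r0 Pr]; rewrite /poly_abs Pr normc_expipi ?ltW. Qed.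

(** The real part of [z exp(- pi i c)]: the orthogonal projection of [z] to the ray
    of phase [c]. *)
Definition ray_part (c : R) (z : R[i]) : R :=
  complex.Re z * cos (pi * c) + complex.Im z * sin (pi * c).

Lemma ray_part_le c z : ray_part c z <= Normc.normc z.
Proof.
case: z => x y; rewrite /ray_part /=.
set C := cos _; set S := sin _; have CS : C ^+ 2 + S ^+ 2 = 1 by exact: cos2Dsin2.
have xy0 : 0 <= x ^+ 2 + y ^+ 2 by rewrite addr_ge0 ?sqr_ge0.
have [neg|pos] := leP (x * C + y * S) 0; first by rewrite (le_trans neg)// sqrtr_ge0.
rewrite -ler_sqr ?nnegrE ?sqrtr_ge0 ?(ltW pos)// sqr_sqrtr//.
(* Lagrange's identity, for the unit vector (C, S). *)
have -> : x ^+ 2 + y ^+ 2 = (x * C + y * S) ^+ 2 + (x * S - y * C) ^+ 2.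
  transitivity ((x ^+ 2 + y ^+ 2) * (C ^+ 2 + S ^+ 2)); first by rewrite CS mulr1.
  by ring.
by rewrite lerDl sqr_ge0.
Qed.

Lemma ray_partD c z w : ray_part c (z + w) = ray_part c z + ray_part c w.
Proof. by rewrite /ray_part !raddfD /=; ring. Qed.

Lemma ray_part_sum c n (z : 'I_n -> R[i]) :
  ray_part c (\sum_i z i) = \sum_i ray_part c (z i).
Proof.
elim/big_ind2: _ => [|x x' y y' <- <-|//]; rewrite ?ray_partD//.
by rewrite /ray_part !raddf0 !mul0r addr0.
Qed.

Lemma ray_part_expipi c r t : ray_part c (r%:C%C * expipi t) = r * cos (pi * (t - c)).
Proof. by rewrite /ray_part /= mulrBr cosB; ring. Qed.

Lemma cos_sector (e x : R) : 0 <= e <= 1 -> `|x| <= e -> cos (pi * e) <= cos (pi * x).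
Proof.
move=> /andP[e0 e1] xe.
have -> : cos (pi * x) = cos (pi * `|x|).
  by rewrite -cos_norm normrM (ger0_norm (pi_ge0 R)).
have pi0 := pi_ge0 R.
have I (y : R) : 0 <= y <= 1 -> pi * y \in `[0, pi].
  by move=> /andP[y0 y1]; rewrite in_itv /= mulr_ge0//= ler_piMr.
rewrite leNgt ltr_cos ?I ?e0// -?leNgt ?ler_wpM2l//.
by rewrite normr_ge0 (le_trans xe).
Qed.

(** This is [tan (pi e) < 1]; it is where the bound [1/4] on the radius of the balls
    enters. *)
Lemma cos_sub_sin_gt0 (e : R) : 0 < e < 4^-1 -> 0 < cos (pi * e) - sin (pi * e).
Proof.
move=> /andP[e0 e1]; have pi0 := pi_gt0 R; rewrite subr_gt0.
have -> : sin (pi * e) = cos (pi / 2 - pi * e) by rewrite cosB cos_pihalf sin_pihalf; ring.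
by rewrite ltr_cos ?in_itv/=; nra.
Qed.

End PolyAbs.
(** * Comparison of the semi-norms *)

Section Seminorm.
Variables (R : realType) (D : triangulatedCat).
Implicit Types (s t : stab R D) (U V : homK R D) (E : D).

Local Notation val_abs U E := (poly_abs (U (K0_class E))).

Lemma semistable_abs_gt0 s E : semistable s E ->
  \forall m \near +oo%R, 0 < val_abs (central_charge s) E m.
Proof.
by move=> [E0 [phi sE]]; apply: has_phase_poly_abs_gt0 (central_charge_phase E0 sE).
Qed.

Lemma seminorm_ge0 s U : (0 <= seminorm s U)%E.
Proof. by apply: ereal_sup_ubound; left. Qed.

(** Upper limits are traded for inequalities that hold for all large [m], at the
    price of an arbitrarily small increase of the constant. *)
Lemma seminorm_leP s U (L : R) : 0 <= L ->
  (seminorm s U <= L%:E)%E <->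
  forall E, semistable s E -> forall L', L < L' -> \forall m \near +oo%R,
    val_abs U E m <= L' * val_abs (central_charge s) E m.
Proof.
move=> L0; split=> [UL E sE L' LL'|UL].
  have /ereal_inf_lt[_ [A FA <-] AL'] : (limf_esup (fun m : R =>
      (val_abs U E m / val_abs (central_charge s) E m)%:E) +oo%R < L'%:E)%E.
    rewrite (le_lt_trans _ (_ : L%:E < _)%E) ?lte_fin// (le_trans _ UL)//.
    by apply: ereal_sup_ubound; right; exists E.
  apply: filterS2 FA (semistable_abs_gt0 sE) => m Am Z0.
  rewrite -ler_pdivrMr// -lee_fin (le_trans _ (ltW AL'))//.
  by apply: ereal_sup_ubound; exists m.
apply: ge_ereal_sup => _ [->|[E sE ->]]; first by rewrite lee_fin.
apply/lee_addgt0Pr => e e0; rewrite -EFinD.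
have A : \forall m \near +oo%R,
    val_abs U E m / val_abs (central_charge s) E m <= L + e.
  have := UL E sE (L + e); rewrite ltrDl => /(_ e0).
  by apply: filterS2 (semistable_abs_gt0 sE) => m Z0; rewrite ler_pdivrMr.
apply: le_trans; first by apply: ereal_inf_lbound; eexists; first exact: A.
by apply: ge_ereal_sup => _ [m Am <-]; rewrite lee_fin.
Qed.

Lemma seminorm_fin s U (L : \bar R) : (seminorm s U < L)%E ->
  exists2 L0 : R, 0 <= L0 & seminorm s U = L0%:E.
Proof.
have := seminorm_ge0 s U; case: (seminorm s U) => [L0||]//.
  by rewrite lee_fin => L00 _; exists L0.
by move=> _; rewrite ltNge leey.
Qed.

Lemma seminorm_lt_near s U L E : (seminorm s U < L%:E)%E -> semistable s E ->
  \forall m \near +oo%R, val_abs U E m <= L * val_abs (central_charge s) E m.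
Proof.
move=> UL sE; have [L0 L00 UL0] := seminorm_fin UL.
have /seminorm_leP : (seminorm s U <= L0%:E)%E by rewrite UL0.
by apply=> //; move: UL; rewrite UL0 lte_fin.
Qed.

Lemma seminorm_triangle s U V : (seminorm s (U + V)%R <= seminorm s U + seminorm s V)%E.
Proof.
have [->|] := eqVneq (seminorm s U) +oo%E.
  by rewrite addye ?leey// gt_eqF// (lt_le_trans _ (seminorm_ge0 _ _)).
rewrite -ltey => /seminorm_fin[a a0 Ua].
have [->|] := eqVneq (seminorm s V) +oo%E.
  by rewrite addey ?leey// Ua.
rewrite -ltey => /seminorm_fin[b b0 Vb].
rewrite Ua Vb -EFinD; apply/seminorm_leP => [|E sE L' abL']; first exact: addr_ge0.
have d0 : 0 < (L' - (a + b)) / 2 by rewrite divr_gt0// subr_gt0.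
set d := _ / _ in d0.
have Ha := (seminorm_leP s U a0).1 _ E sE (a + d).
have Hb := (seminorm_leP s V b0).1 _ E sE (b + d).
rewrite Ua Vb !lexx !ltrDl in Ha Hb.
apply: filterS2 (Ha isT d0) (Hb isT d0) => m UE VE.
rewrite (le_trans (poly_abs_triangle _ _ _))// (le_trans (lerD UE VE))//.
rewrite -mulrDl ler_wpM2r ?poly_abs_ge0// /d; lra.
Qed.

Lemma seminormZ_le s (c : R[i]) U (a : R) : (seminorm s U <= a%:E)%E ->
  (seminorm s (c *: U)%R <= (Normc.normc c * a)%:E)%E.
Proof.
move=> Ua; have a0 : 0 <= a by rewrite -lee_fin (le_trans (seminorm_ge0 s U)).
have c0 : 0 <= Normc.normc c by case: (c) => x y; rewrite sqrtr_ge0.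
apply/seminorm_leP => [|E sE L' caL']; first exact: mulr_ge0.
have L'0 : 0 < L' by rewrite (le_lt_trans _ caL')// mulr_ge0.
have [cz|cn] := eqVneq (Normc.normc c) 0.
  by apply: nearW => m; rewrite poly_absZ cz mul0r mulr_ge0 ?poly_abs_ge0// ltW.
have {}c0 : 0 < Normc.normc c by rewrite lt_neqAle eq_sym cn.
have /(_ E sE (L' / Normc.normc c)) := (seminorm_leP s U a0).1 Ua.
rewrite ltr_pdivlMr// mulrC => /(_ caL').
by apply: filterS => m Um; rewrite poly_absZ mulrC -ler_pdivlMr// mulrAC.
Qed.

Lemma seminorm0 s : seminorm s 0 = 0%E.
Proof.
apply/le_anti; rewrite seminorm_ge0 andbT; apply/seminorm_leP => // E sE L' L'0.
by apply: nearW => m; rewrite poly_abs0 mulr_ge0 ?poly_abs_ge0// ltW.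
Qed.

(** For large [m] all [Z(A_i)(m)] lie within angle [pi e] of the ray of phase [c], so
    projecting to this ray gives [cos (pi e) * sum |Z(A_i)| <= |Z(E)|], whereas
    [|U(E)| <= sum |U(A_i)| <= L * sum |Z(A_i)|]. *)
Lemma sector_bound s E (c e L : R) U : ~ is_zero E -> 0 < e < 2^-1 ->
  `|phi_plus (slices s) E - c| < e -> `|phi_minus (slices s) E - c| < e ->
  (seminorm s U < L%:E)%E ->
  \forall m \near +oo%R,
    cos (pi * e) * val_abs U E m <= L * val_abs (central_charge s) E m.
Proof.
move=> E0 /andP[e0 e1] plus minus UL.
have L0 : 0 < L by rewrite -lte_fin (le_lt_trans (seminorm_ge0 s U)).
have [F] := sl_HN (slices s) E0; rewrite (phi_plusE F E0) in plus.
rewrite (phi_minusE F E0) in minus.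
(* What is needed of the i-th factor at the argument m; r is |Z(A_i)(m)|. *)
pose good (i : 'I_(hn_len F)) : set R := [set m | `|repr (hn_phase F i) m%:E - c| < e /\
    exists2 r : R, 0 < r &
      (central_charge s (K0_class (hn_fac F i))).[m%:C%C] =
        r%:C%C * expipi (repr (hn_phase F i) m%:E) /\
      val_abs U (hn_fac F i) m <= L * r].
have near_fac (i : 'I_(hn_len F)) : \forall m \near +oo%R, good i m.
  have iF := ltn_ord i.
  have lim_c : `|phase_lim (hn_phase F i) - c| < e.
    have up : phase_lim (hn_phase F i) <= phase_lim (hn_phase F 0%N).
      exact: hn_phase_le.
    have lo : phase_lim (hn_phase F (hn_len F).-1) <= phase_lim (hn_phase F i).
      by apply: hn_phase_le; rewrite -ltnS prednK ?iF ?leqnn// (leq_ltn_trans _ iF).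
    move: plus minus; rewrite !ltr_distl => /andP[_ p] /andP[q _].
    by rewrite (lt_le_trans q)// (le_lt_trans up).
  have cvg_c : \forall m \near +oo%R, `|repr (hn_phase F i) m%:E - c| < e.
    have : (fun m : R => `|repr (hn_phase F i) m%:E - c|) @ +oo%R -->
        `|phase_lim (hn_phase F i) - c|.
      by apply: cvg_norm; apply: cvgB; [exact: phase_lim_cvg|exact: cvg_cst].
    by move/cvgr_lt; apply.
  have fac_ss : semistable s (hn_fac F i).
    by split; [exact: hn_fac_neq0|exists (hn_phase F i); exact: hn_fac_ss].
  have Zph := central_charge_phase (hn_fac_neq0 iF) (hn_fac_ss iF).
  apply: filterS3 cvg_c Zph (seminorm_lt_near UL fac_ss) => m mc [r r0 Zr] Um.
  split=> //; exists r => //; split=> //; move: Um.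
  by rewrite /poly_abs Zr (normc_expipi _ (ltW r0)).
have : \forall m \near +oo%R, forall i, good i m.
  refine (@filter_forall _ _ good +oo%R _ near_fac).
apply: filterS => m Hm.
have /choice[r Hr] : forall i : 'I_(hn_len F), exists r : R, [/\ 0 < r,
      (central_charge s (K0_class (hn_fac F i))).[m%:C%C] =
        r%:C%C * expipi (repr (hn_phase F i) m%:E) &
      val_abs U (hn_fac F i) m <= L * r].
  by move=> i; have [_ [r r0 [Zr Ur]]] := Hm i; exists r.
have cos0 : 0 < cos (pi * e).
  have pi0 := pi_gt0 R; apply: cos_gt0_pihalf; apply/andP; split; nra.
have ZE : cos (pi * e) * (\sum_i r i) <= val_abs (central_charge s) E m.
  rewrite /poly_abs (homK_hn _ F) horner_sum (le_trans _ (ray_part_le c _))//.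
  rewrite ray_part_sum mulr_sumr; apply: ler_sum => i _.
  have [ri0 -> _] := Hr i; have [mc _] := Hm i.
  rewrite ray_part_expipi mulrC ler_wpM2l ?(ltW ri0)// cos_sector ?(ltW mc)//.
  by rewrite (ltW e0) (le_trans (ltW e1))// invf_le1 ?ler1n.
have UE : val_abs U E m <= L * (\sum_i r i).
  rewrite (homK_hn U F) (le_trans (poly_abs_sum _ _))// mulr_sumr.
  by apply: ler_sum => i _; have [] := Hr i.
rewrite (le_trans (ler_wpM2l (ltW cos0) UE))// mulrCA.
by rewrite ler_wpM2l ?(ltW L0).
Qed.

(** [|U|_t <= C |U|_s] for all [U], in a form that makes sense for infinite
    semi-norms and composes without case analysis. *)
Definition dominates s t := exists2 C : R, 0 < C &
  forall U (L : R), (seminorm s U < L%:E)%E -> (seminorm t U < (C * L)%:E)%E.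

Lemma dominates_refl s : dominates s s.
Proof. by exists 1 => // U L; rewrite mul1r. Qed.

Lemma dominates_trans t s u : dominates s t -> dominates t u -> dominates s u.
Proof.
move=> [C C0 st] [C' C'0 tu]; exists (C' * C); first exact: mulr_gt0.
by move=> U L /st/tu; rewrite mulrA.
Qed.

(** Adding [1] to the constant turns the weak inequality obtained from estimates
    for large [m] into the strict one of [dominates]. *)
Lemma dominates_near s t (K : R) : 0 < K ->
  (forall U L E, (seminorm s U < L%:E)%E -> 0 < L -> semistable t E ->
    \forall m \near +oo%R, val_abs U E m <= K * L * val_abs (central_charge t) E m) ->
  dominates s t.
Proof.
move=> K0 st; exists (K + 1) => [|U L UL]; first by rewrite addr_gt0.
have L0 : 0 < L by rewrite -lte_fin (le_lt_trans (seminorm_ge0 s U)).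
rewrite (@le_lt_trans _ _ (K * L)%:E) ?lte_fin ?ltr_pM2r ?ltrDl//.
apply/seminorm_leP => [|E tE L' KLL']; first by rewrite mulr_ge0// ltW.
apply: filterS (st U L E UL L0 tE) => m /le_trans; apply.
by rewrite ler_wpM2r ?poly_abs_ge0// ltW.
Qed.

Lemma slicing_dist_lt (P Q : slicing R D) (e : R) X :
  (slicing_dist P Q < e%:E)%E -> ~ is_zero X ->
  `|phi_plus P X - phi_plus Q X| < e /\ `|phi_minus P X - phi_minus Q X| < e.
Proof.
move=> PQ X0; split; rewrite -lte_fin (le_lt_trans _ PQ)//.
  by apply: ereal_sup_ubound; right; exists X => //; right.
by apply: ereal_sup_ubound; right; exists X => //; left.
Qed.

(** From [s] to [t], a [t]-semistable object is spread over a small sector by [s],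
    and [(cos - sin) |Z(E)| <= cos |W(E)|] replaces [Z] by [W].  From [t] to [s], an
    [s]-semistable object is spread by [t], and [|W(E)| <= (1 + sin) |Z(E)|] is
    immediate from [|W - Z|_s < sin (pi e)]. *)
Lemma ball_dominates s t e : 0 < e < 4^-1 -> stab_ball s e t ->
  dominates s t /\ dominates t s.
Proof.
move=> e4 [ZW PQ]; have cs0 := cos_sub_sin_gt0 e4.
have e2 : 0 < e < 2^-1 by lra.
have sin0 : 0 < sin (pi * e).
  by rewrite -lte_fin (le_lt_trans _ ZW)// seminorm_ge0.
have cos0 : 0 < cos (pi * e) by rewrite (lt_trans sin0)// -subr_gt0.
set S := sin _ in ZW cs0 sin0 *; set C := cos _ in cs0 cos0 *.
split.
- apply: (@dominates_near _ _ (C - S)^-1); first by rewrite invr_gt0.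
  move=> U L E UL L0 [E0 [psi tE]].
  have [plus minus] := slicing_dist_lt PQ E0.
  rewrite (phi_plus_semistable E0 tE) in plus.
  rewrite (phi_minus_semistable E0 tE) in minus.
  apply: filterS2 (sector_bound E0 e2 plus minus UL)
    (sector_bound E0 e2 plus minus ZW) => m.
  rewrite -/C => Um Wm.
  have Zm : val_abs (central_charge s) E m <= val_abs (central_charge t) E m +
      val_abs (central_charge t - central_charge s)%R E m.
    rewrite -(poly_absN ((central_charge t - central_charge s)%R _)).
    rewrite (le_trans _ (poly_abs_triangle _ _ _))//.
    by rewrite /= opprB addrC subrK.
  rewrite -mulrA ler_pdivlMl// -(ler_pM2l cos0).
  have h1 : C * val_abs (central_charge s) E m <= C * val_abs (central_charge t) E m +
      S * val_abs (central_charge s) E m.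
    by rewrite (le_trans (ler_wpM2l (ltW cos0) Zm))// mulrDr lerD2l.
  have h2 : (C - S) * val_abs (central_charge s) E m <= C * val_abs (central_charge t) E m.
    by rewrite mulrBl lerBlDr.
  rewrite mulrCA (le_trans (ler_wpM2l (ltW cs0) Um))//.
  by rewrite mulrCA [leRHS]mulrCA ler_wpM2l ?(ltW L0).
- apply: (@dominates_near _ _ ((1 + S) / C)); first by rewrite divr_gt0// addr_gt0.
  move=> U L E UL L0 sE; have [E0 [psi sE']] := sE.
  have [] := slicing_dist_lt PQ E0.
  rewrite (phi_plus_semistable E0 sE') (phi_minus_semistable E0 sE').
  rewrite distrC => plus; rewrite distrC => minus.
  apply: filterS2 (sector_bound E0 e2 plus minus UL) (seminorm_lt_near ZW sE) => m.
  rewrite -/C => Um Wm.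
  have Wm' : val_abs (central_charge t) E m <= (1 + S) * val_abs (central_charge s) E m.
    have -> : central_charge t (K0_class E) = central_charge s (K0_class E) +
        (central_charge t - central_charge s)%R (K0_class E).
      by rewrite /= addrC subrK.
    by rewrite (le_trans (poly_abs_triangle _ _ _))// mulrDl mul1r lerD2l.
  rewrite (_ : _ * L * _ = L * ((1 + S) * val_abs (central_charge s) E m) / C); last by ring.
  rewrite ler_pdivlMr// mulrC (le_trans Um)//.
  by rewrite ler_wpM2l ?(ltW L0).
Qed.

End Seminorm.

(** * Constancy on connected components *)

Section StabTopology.
Variables (R : realType) (D : triangulatedCat).
Implicit Types (s t : stab R D) (U V : homK R D).

Lemma slicing_dist_refl (P : slicing R D) : slicing_dist P P = 0%E.
Proof.
apply/le_anti/andP; split; last by apply: ereal_sup_ubound; left.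
by apply: ge_ereal_sup => _ [->|[X _ [->|->]]]; rewrite ?subrr ?normr0.
Qed.

Lemma stab_ball_center s e : 0 < e < 4^-1 -> stab_ball s e s.
Proof.
move=> /andP[e0 e4]; split; last by rewrite slicing_dist_refl lte_fin.
rewrite subrr seminorm0 lte_fin; apply: sin_gt0_pihalf.
have pi0 := pi_gt0 R; apply/andP; split; nra.
Qed.

Lemma stab_ball_open s e : 0 < e < 4^-1 -> open (stab_ball s e : set (stab R D)).
Proof. by move=> e4; apply: generated_open; left; exists s, e. Qed.

Lemma central_charge_continuous : continuous (@central_charge R D).
Proof.
apply/continuousP => O oO; apply: generated_open; right; exists O => //.
Qed.

(** Balls of one fixed radius either consist of points equivalent to [x] or
    contain none, so the equivalence class of [x] is open and closed. *)
Lemma connected_component_dominates x t :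
  connected_component [set: stab R D] x t -> dominates x t /\ dominates t x.
Proof.
pose E := [set t | dominates x t /\ dominates t x].
have e8 : 0 < (8^-1 : R) < 4^-1 by lra.
have ballE s t' : stab_ball s 8^-1 t' -> E s <-> E t'.
  move=> /(ball_dominates e8)[st ts]; split=> -[a b].
    by split; [exact: dominates_trans a st|exact: dominates_trans ts b].
  by split; [exact: dominates_trans a ts|exact: dominates_trans st b].
have ball_nbhs s : nbhs s (stab_ball s 8^-1).
  by apply: open_nbhs_nbhs; split; [exact: stab_ball_open|exact: stab_ball_center].
have oE : open E.
  rewrite openE => s Es; apply: filterS (ball_nbhs s) => t' /ballE[+ _]; exact.
have cE : closed E.
  rewrite -openC openE => s Es; apply: filterS (ball_nbhs s) => t' /ballE[_ +] Et'.
  by move/(_ Et').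
move=> [A [Ax _ conA] At].
have /conA : (A `&` E !=set0) by exists x; split=> //; split; exact: dominates_refl.
move=> /(_ (ex_intro2 _ _ E oE erefl) (ex_intro2 _ _ E cE erefl)) AE.
by move: At; rewrite -AE => -[].
Qed.

Lemma seminorm_lt_leD s U V (a b : R) : (seminorm s U < a%:E)%E ->
  (seminorm s V <= b%:E)%E -> (seminorm s (U + V)%R < (a + b)%:E)%E.
Proof.
move=> Ua Vb; rewrite (le_lt_trans (seminorm_triangle _ _ _))// EFinD.
by have [r _ rE] := seminorm_fin (le_lt_trans Vb (ltry b)); rewrite rE lte_leD// -rE.
Qed.

Lemma seminorm_central_charge s : (seminorm s (central_charge s) <= 1%:E)%E.
Proof.
apply/seminorm_leP => // E sE L L1; apply: nearW => m.
by rewrite ler_peMl ?poly_abs_ge0// ltW.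
Qed.

End StabTopology.

(** * The topological vector space of finite charges *)

Section FiniteCharges.
Variables (R : realType) (D : triangulatedCat) (Sigma : set (stab R D)).

(** On a connected component finiteness at one point implies it at all others;
    asking for all of them avoids a base point. *)
Definition is_finite_charge : {pred homK R D} :=
  [pred U | `[< forall s, Sigma s -> (seminorm s U < +oo)%E >]].

Fact is_finite_charge_submod_closed : submod_closed is_finite_charge.
Proof.
split=> [|c U V /asboolW HU /asboolW HV]; apply: asboolT => s Ss.
  by rewrite seminorm0.
rewrite (le_lt_trans (seminorm_triangle _ _ _))//.
have [a _ Ua] := seminorm_fin (HU s Ss).
by rewrite lte_add_pinfty ?HV// (le_lt_trans (seminormZ_le c (a := a) _)) ?Ua// ltry.
Qed.

HB.instance Definition _ := GRing.isSubmodClosed.Build R[i] (homK R D)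
  is_finite_charge is_finite_charge_submod_closed.

Record finite_charge := FiniteCharge {
  charge_val :> homK R D;
  charge_valP : charge_val \in is_finite_charge }.

HB.instance Definition _ := [isSub for charge_val].
HB.instance Definition _ := [Choice of finite_charge by <:].
HB.instance Definition _ := [SubChoice_isSubLmodule of finite_charge by <:].

HB.instance Definition _ := Topological.copy finite_charge
  (generated_topology
    (seminorm_subbasis Sigma (charge_val : finite_charge -> homK R D))).

Implicit Types v w : finite_charge.

Lemma seminorm_charge s v : Sigma s -> exists2 a : R, 0 <= a & seminorm s v = a%:E.
Proof. by move=> Ss; apply: seminorm_fin (asboolW (charge_valP v) s Ss). Qed.

Lemma charge_val_continuous : continuous charge_val.
Proof. by apply/continuousP => O oO; apply: generated_open; left; exists O. Qed.

Lemma seminorm_ball_nbhs s v (e : R) : Sigma s -> 0 < e ->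
  nbhs v [set w | (seminorm s (w - v : homK R D)%R < e%:E)%E].
Proof.
move=> Ss e0; apply: open_nbhs_nbhs; split; last by rewrite /= subrr seminorm0 lte_fin.
by apply: generated_open; right; exists s, v, e.
Qed.

Lemma finite_charge_add_continuous :
  continuous (fun z : finite_charge * finite_charge => z.1 + z.2).
Proof.
move=> [v w]; apply: generated_cvg => A [[G oG <-] /= Gvw|[s [a [e [Ss e0 ->]]]] /= vwa].
  have := @homK_add_continuous R D (charge_val v, charge_val w) G
    (open_nbhs_nbhs (conj oG Gvw)).
  move=> [ [P Q] [/= vP wQ] PQ].
  exists (charge_val @^-1` P, charge_val @^-1` Q).
    by split; apply: charge_val_continuous.
  by move=> [v' w'] [/= v'P w'Q]; exact: (PQ (charge_val v', charge_val w')).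
have [r r0 rE] := seminorm_fin vwa; move: vwa; rewrite rE lte_fin => re.
have d0 : 0 < (e - r) / 2 by rewrite divr_gt0// subr_gt0.
(* The margin e - r is split between the two summands. *)
set d := _ / _ in d0.
exists ([set v' | (seminorm s (v' - v : homK R D)%R < d%:E)%E],
        [set w' | (seminorm s (w' - w : homK R D)%R < d%:E)%E]).
  by split; exact: seminorm_ball_nbhs.
move=> [v' w'] [/= vd wd].
have -> : (charge_val (v' + w') - charge_val a =
    (charge_val v' - charge_val v) +
    ((charge_val w' - charge_val w) + (charge_val (v + w) - charge_val a)) :> homK R D)%R.
  rewrite -[charge_val (v' + w')]/(charge_val v' + charge_val w').
  rewrite -[charge_val (v + w)]/(charge_val v + charge_val w).
  by rewrite [RHS]addrA (addrACA (charge_val v')) -opprD addrA subrK.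
rewrite (_ : e = d + (d + r)); last by rewrite /d; lra.
by apply: seminorm_lt_leD => //; apply: ltW; apply: seminorm_lt_leD; rewrite ?rE.
Qed.

Lemma finite_charge_scale_continuous :
  continuous (fun z : R[i]^o * finite_charge => z.1 *: z.2).
Proof.
move=> [c v]; apply: generated_cvg => A [[G oG <-] /= Gcv|[s [a [e [Ss e0 ->]]]] /= cva].
  have := @homK_scale_continuous R D (c, charge_val v) G (open_nbhs_nbhs (conj oG Gcv)).
  move=> [[P Q] [/= cP vQ] PQ].
  exists (P, charge_val @^-1` Q); first by split => //; exact: charge_val_continuous.
  by move=> [c' v'] [/= c'P v'Q]; exact: (PQ (c', charge_val v')).
have [r r0 rE] := seminorm_fin cva; move: cva; rewrite rE lte_fin => re.
have d0 : 0 < (e - r) / 2 by rewrite divr_gt0// subr_gt0.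
set d := _ / _ in d0.
have [N N0 NE] := seminorm_charge v Ss.
have normc_ge0 (x : R[i]) : 0 <= Normc.normc x by case: x => ? ?; rewrite sqrtr_ge0.
have c10 : 0 < Normc.normc c + 1 by rewrite ltr_wpDl.
have N10 : 0 < N + 1 by rewrite ltr_wpDl.
(* Chosen for c'v' - cv = c'(v' - v) + (c' - c)v, where |c'| <= |c| + 1; the
   denominator N + 1 also covers |v| = 0. *)
exists ([set c' : R[i]^o | Normc.normc (c' - c) < Num.min 1 (d / (N + 1))],
        [set v' | (seminorm s (v' - v : homK R D)%R < (d / (Normc.normc c + 1))%:E)%E]).
  split; last by apply: seminorm_ball_nbhs => //; rewrite divr_gt0.
  apply/complex_nbhsP; exists (Num.min 1 (d / (N + 1))) => //.
  by rewrite lt_min ltr01 divr_gt0.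
move=> [c' v'] [/= ]; rewrite lt_min => /andP[c1 cd] vd.
have -> : (charge_val (c' *: v') - charge_val a =
    (c' *: (charge_val v' - charge_val v)) +
    ((c' - c) *: charge_val v + (charge_val (c *: v) - charge_val a)) :> homK R D)%R.
  rewrite -[charge_val (c' *: v')]/(c' *: charge_val v').
  rewrite -[charge_val (c *: v)]/(c *: charge_val v).
  by rewrite scalerBr scalerBl !addrA subrK addrNK.
rewrite (_ : e = d + (d + r)); last by rewrite /d; lra.
have c'1 : Normc.normc c' <= Normc.normc c + 1.
  by rewrite -(subrK c c') addrC (le_trans (le_normcD _ _))// lerD2l ltW.
apply: seminorm_lt_leD.
  have [x x0 xE] := seminorm_fin vd; move: vd; rewrite xE lte_fin ltr_pdivlMr// mulrC => xd.
  rewrite (le_lt_trans (seminormZ_le c' (a := x) _)) ?xE// lte_fin.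
  by rewrite (le_lt_trans _ xd)// ler_wpM2r.
apply: (@le_trans _ _ (d%:E + r%:E)%E); last by rewrite EFinD.
rewrite (le_trans (seminorm_triangle _ _ _))// leeD ?rE//.
rewrite (le_trans (seminormZ_le _ (a := N) _)) ?NE// lee_fin.
move: cd; rewrite ltr_pdivlMr// => /ltW; apply: le_trans.
by rewrite ler_wpM2l ?normc_ge0// lerDl.
Qed.

HB.instance Definition _ :=
  PreTopologicalNmodule_isTopologicalNmodule.Build finite_charge
    finite_charge_add_continuous.
HB.instance Definition _ :=
  TopologicalNmodule_isTopologicalLmodule.Build R[i] finite_charge
    finite_charge_scale_continuous.

End FiniteCharges.

(** The bound [sin (pi e)] on the semi-norm in a ball of radius [e] can thus be made
    as small as desired. *)
Lemma sin_small (R : realType) (d : R) : 0 < d ->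
  exists e : R, 0 < e < 4^-1 /\ sin (pi * e) < d.
Proof.
move=> d0.
have c : sin (pi * x) @[x --> (0 : R)] --> sin (pi * 0 : R).
  by apply: continuous_comp; [exact: mulrl_continuous|exact: continuous_sin].
have /nbhs_ballP[x /= x0 xd] : \forall y \near (0 : R), sin (pi * y) < d.
  by apply: (cvgr_lt _ c); rewrite mulr0 sin0.
exists (Num.min (x / 2) 8^-1); split.
  rewrite lt_min divr_gt0//= gt_min; apply/andP; split; first by lra.
  by apply/orP; right; lra.
apply: xd; rewrite -ball_normE /= sub0r normrN ger0_norm.
  by rewrite gt_min ltr_pdivrMr// ltr_pMr// ltr1n.
by rewrite le_min ltW ?divr_gt0//=; lra.
Qed.

Theorem proposition8p1p3 (R : realType) (D : triangulatedCat)
    (Sigma : set (stab R D)) (hSigma : is_connected_component Sigma) :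
  exists (V : topologicalLmodType R[i]) (iota : {linear V -> homK R D}),
    [/\ injective iota,
        forall s, Sigma s -> range iota = [set U | (seminorm s U < +oo)%E],
        @open V = @open (generated_topology (seminorm_subbasis Sigma iota))
      & exists f : set_type Sigma -> V,
          continuous f /\ forall s, iota (f s) = central_charge (set_val s)].
Proof.
have [x xSigma] := hSigma.
have dom s t : Sigma s -> Sigma t -> dominates s t.
  rewrite xSigma => /connected_component_dominates[_ sx].
  by move=> /connected_component_dominates[xt _]; exact: dominates_trans sx xt.
have fin s U : Sigma s -> (seminorm s U < +oo)%E -> U \in is_finite_charge Sigma.
  move=> Ss /seminorm_fin[a a0 Ua]; apply: asboolT => t St.
  have [C C0 /(_ U (a + 1))] := dom s t Ss St.
  by rewrite Ua lte_fin ltrDl => /(_ ltr01)/lt_trans; apply; rewrite ltry.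
have finZ (s : set_type Sigma) : central_charge (set_val s) \in is_finite_charge Sigma.
  apply: (fin (set_val s)); first exact: set_valP.
  by rewrite (le_lt_trans (seminorm_central_charge _))// ltry.
exists (finite_charge Sigma : topologicalLmodType R[i]).
exists (\val : {linear finite_charge Sigma -> homK R D}).
split.
- exact: val_inj.
- move=> s Ss; apply/seteqP; split=> [_ [v _ <-]|U /= Us] /=.
    exact: (asboolW (charge_valP v)).
  by exists (FiniteCharge (fin s U Ss Us)).
- by [].
exists (fun s => FiniteCharge (finZ s)); split=> // s.
have cset : continuous (set_val : set_type Sigma -> stab R D).
  exact: initial_continuous.
apply: generated_cvg; first by apply: fmap_filter; exact: (@nbhs_filter (set_type Sigma) s).
move=> A [[G oG <-] /= GZ|[t [a [e [St e0 ->]]]] /= sa].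
  have ZG : nbhs (set_val s) (@central_charge R D @^-1` G).
    by apply: central_charge_continuous; apply: open_nbhs_nbhs.
  exact: (cset s _ ZG).
have [r r0 rE] := seminorm_fin sa; move: sa; rewrite rE lte_fin => re.
have Ss : Sigma (set_val s) by exact: set_valP.
have [C C0 domC] := dom _ _ Ss St.
have [|d [d4 sind]] := @sin_small R ((e - r) / C); first by rewrite divr_gt0// subr_gt0.
have : nbhs s (set_val @^-1` stab_ball (set_val s) d).
  by apply: cset; apply: open_nbhs_nbhs; split; [exact: stab_ball_open|exact: stab_ball_center].
apply: filterS => t' [/domC Ct' _] /=.
have -> : (central_charge (set_val t') - charge_val a =
   (central_charge (set_val t') - central_charge (set_val s)) +
   (central_charge (set_val s) - charge_val a) :> homK R D)%R by rewrite addrA subrK.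
rewrite -(subrK r e); apply: seminorm_lt_leD; last by rewrite rE.
by rewrite (lt_trans Ct')// lte_fin mulrC -ltr_pdivlMr.
Qed.
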